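(* Let $\Omega\subset\mathbb{R}^n$ be a bounded domain with Lipschitz boundary, $F\in (L^2(\Omega))^n$, $H\in L^2(\Omega)$, and let $\varphi:\Omega\times\mathbb{R}^n\to\mathbb{R}$ be continuous, convex in its second argument, and such that (i) there is $\alpha>0$ with $0\le \varphi(x,\xi)\le \alpha|\xi|$ for all $x\in\Omega$, $\xi\in\mathbb{R}^n$, and (ii) $\xi\mapsto\varphi(x,\xi)$ is a norm on $\mathbb{R}^n$ for every $x\in\Omega$. Assume that the primal problem $$(P')\qquad \inf_{u\in H^1_0(\Omega)} \int_\Omega \big(\varphi(x,\nabla u+F)+Hu\big)\,dx$$ is bounded below. Then there exists a vector field $N\in\widetilde{\mathcal{D}}_0$ with $\varphi^0(x,N(x))\le 1$ for a.e. $x\in\Omega$ which solves the dual problem $$(D')\qquad \sup\Big\{\int_\Omega F\cdot b\,dx \;:\; b\in\widetilde{\mathcal{D}}_0,\ \varphi^0(x,b(x))\le 1 \text{ for a.e. } x\in\Omega\Big\},$$ and the duality gap is zero: $$\inf_{u\in H^1_0(\Omega)} \int_\Omega \big(\varphi(x,\nabla u+F)+Hu\big)\,dx=\int_\Omega F\cdot N\,dx .$$ Moreover, for every minimizer $u\in H^1_0(\Omega)$ of $(P')$, $$\varphi\Big(x,\frac{\nabla u+F}{|\nabla u+F|}\Big)=N\cdot\frac{\nabla u+F}{|\nabla u+F|}\qquad |\nabla u+F|\text{-a.e. in }\Omega,$$ i.e. at a.e. point of $\Omega$ where $\nabla u+F\neq 0$.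
   Context: $\widetilde{\mathcal{D}}_0=\{b\in (L^2(\Omega))^n : \int_\Omega (\nabla u\cdot b+Hu)\,dx=0 \text{ for all } u\in H^1_0(\Omega)\}$. $\varphi^0$ is the dual norm: $\varphi^0(x,\xi)=\sup\{\xi\cdot p : p\in\mathbb{R}^n,\ \varphi(x,p)\le 1\}$. *)

(* Defs.v *)
From HB Require Import structures.
From mathcomp Require Import all_boot all_order all_algebra.
From mathcomp Require Import all_classical all_reals all_analysis.

Set Implicit Arguments.
Unset Strict Implicit.
Unset Printing Implicit Defensive.

Import Order.TTheory GRing.Theory Num.Theory.
Import numFieldNormedType.Exports.

Local Open Scope classical_set_scope.
Local Open Scope ring_scope.

(* R^n is 'rV[R]_n. Its library norm `|x| is the sup norm; it is only used for
   the topology, boundedness and Lipschitz continuity, where the choice of an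
   equivalent norm is immaterial. The Euclidean structure is dotv / enorm. *)

Section euclidean.
Context {R : realType} {n : nat}.

Definition dotv (u v : 'rV[R]_n) : R := \sum_(i < n) u 0 i * v 0 i.

Definition enorm (u : 'rV[R]_n) : R := Num.sqrt (dotv u u).

End euclidean.

(* The sigma-algebra on R^n is the product of the Borel sigma-algebras of the
   coordinates, as the library does for n.-tuple. *)

Section measurable_rV.
Context {R : realType} {n : nat}.

Let coord (i : 'I_n) (v : 'rV[R]_n) : R := v 0 i.

Let rV_set0 : g_sigma_preimage coord set0.
Proof. exact: sigma_algebra0. Qed.

Let rV_setC A : g_sigma_preimage coord A -> g_sigma_preimage coord (~` A).
Proof. exact: sigma_algebraC. Qed.

Let rV_bigcup (F : (set 'rV[R]_n)^nat) :
  (forall i, g_sigma_preimage coord (F i)) ->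
  g_sigma_preimage coord (\bigcup_i (F i)).
Proof. exact: sigma_algebra_bigcup. Qed.

HB.instance Definition _ := @isMeasurable.Build default_measure_display
  'rV[R]_n (g_sigma_preimage coord) rV_set0 rV_setC rV_bigcup.

Lemma measurable_coord (i : 'I_n) :
  measurable_fun [set: 'rV[R]_n] (fun v : 'rV[R]_n => v 0 i).
Proof.
move=> _ Y mY; rewrite setTI; apply: sub_sigma_algebra => /=.
rewrite -bigcup_seq/=; exists i => /=; first by rewrite mem_index_enum.
by exists Y => //; rewrite setTI.
Qed.

Lemma measurable_fun_rV d (T : measurableType d) (f : T -> 'rV[R]_n) :
  (forall i, measurable_fun [set: T] (fun x => f x 0 i)) ->
  measurable_fun [set: T] f.
Proof.
move=> mf; have preI : g_sigma_preimage (fun i x => f x 0 i) `<=` measurable.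
  apply: smallest_sub; first exact: sigma_algebra_measurable.
  move=> A; rewrite -bigcup_seq/= => -[i _ [B mB <-]]; exact: mf.
move=> _ A mA; apply: preI.
have -> : g_sigma_preimage (fun i x => f x 0 i) =
          g_sigma_preimage (fun i => coord i \o f) by [].
by rewrite g_sigma_preimage_comp; exists A.
Qed.

End measurable_rV.

(* Lebesgue measure on R^n, by iterated products: R^n.+1 is R * R^n. *)

Section lebesgue_rV.
Context {R : realType}.

Definition cons_rV n (z : R * 'rV[R]_n) : 'rV[R]_n.+1 :=
  \row_i oapp (fun j => z.2 0 j) z.1 (unlift ord0 i).

Lemma measurable_cons_rV n : measurable_fun setT (@cons_rV n).
Proof.
apply: measurable_fun_rV => i.
rewrite (_ : (fun z => _) = fun z : R * 'rV[R]_n =>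
  oapp (fun j => z.2 0 j) z.1 (unlift ord0 i)); last first.
  by apply/funext => z; rewrite mxE.
case: unliftP => [j|] _ /=; last exact: measurable_fst.
exact: (measurableT_comp (measurable_coord j) measurable_snd).
Qed.

Definition uncons_rV n (v : 'rV[R]_n.+1) : R * 'rV[R]_n :=
  (v 0 ord0, \row_j v 0 (lift ord0 j)).

Lemma measurable_uncons_rV n : measurable_fun setT (@uncons_rV n).
Proof.
apply: measurable_fun_pair; first exact: measurable_coord.
apply: measurable_fun_rV => j.
rewrite (_ : (fun v => _) = fun v : 'rV[R]_n.+1 => v 0 (lift ord0 j)).
  exact: measurable_coord.
by apply/funext => v; rewrite mxE.
Qed.

Lemma cons_rVK n : cancel (@cons_rV n) (@uncons_rV n).
Proof.
move=> [x v]; congr pair; first by rewrite mxE unlift_none.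
by apply/rowP => j; rewrite !mxE liftK.
Qed.

Section step.
Variables (n : nat) (mu : {sigma_finite_measure set 'rV[R]_n -> \bar R}).

Definition lebesgue_step : set 'rV[R]_n.+1 -> \bar R :=
  pushforward (@lebesgue_measure R \x mu)%E (@cons_rV n).

Let lebesgue_step0 : lebesgue_step set0 = 0%E.
Proof. by rewrite /lebesgue_step /pushforward preimage_set0 measure0. Qed.

Let lebesgue_step_ge0 A : (0 <= lebesgue_step A)%E.
Proof. by rewrite /lebesgue_step /pushforward measure_ge0. Qed.

Let lebesgue_step_sigma_additive : semi_sigma_additive lebesgue_step.
Proof.
move=> F mF tF mUF; rewrite /lebesgue_step /pushforward preimage_bigcup.
apply: measure_semi_sigma_additive.
- by move=> k; rewrite -[X in measurable X]setTI; exact: measurable_cons_rV.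
- apply/trivIsetP => /= i j _ _ ij; rewrite -preimage_setI.
  by move/trivIsetP : tF => /(_ _ _ _ _ ij) ->//; rewrite preimage_set0.
- rewrite -preimage_bigcup -[X in measurable X]setTI.
  exact: measurable_cons_rV.
Qed.

HB.instance Definition _ := isMeasure.Build _ _ _ lebesgue_step
  lebesgue_step0 lebesgue_step_ge0 lebesgue_step_sigma_additive.

Let lebesgue_step_sigma_finite : sigma_finite setT lebesgue_step.
Proof.
have /sigma_finiteP[F [FT ndF Foo]] := sigma_finiteT (@lebesgue_measure R).
have /sigma_finiteP[G [GT ndG Goo]] := sigma_finiteT mu.
exists (fun i => @uncons_rV n @^-1` (F i `*` G i)).
  apply/esym; rewrite -subTset => v _.
  have [i _ Fi] : (\bigcup_i F i) (v 0 ord0) by rewrite -FT.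
  have [j _ Gj] : (\bigcup_i G i) (uncons_rV v).2 by rewrite -GT.
  exists (maxn i j) => //=; split.
    by move: Fi; apply/subsetPset/ndF/leq_maxl.
  by move: Gj; apply/subsetPset/ndG/leq_maxr.
move=> i; have [mF Fi] := Foo i; have [mG Gi] := Goo i; split.
  rewrite -[X in measurable X]setTI; apply: measurable_uncons_rV => //.
  exact: measurableX.
rewrite /lebesgue_step /pushforward -comp_preimage.
rewrite (_ : _ \o _ = id) ?preimage_id; last first.
  by apply/funext => z /=; rewrite cons_rVK.
by rewrite product_measure1E// lte_mul_pinfty// ge0_fin_numE.
Qed.

HB.instance Definition _ := Measure_isSigmaFinite.Build _ _ _ lebesgue_step
  lebesgue_step_sigma_finite.

End step.

Fixpoint lebesgue_rV n : {sigma_finite_measure set 'rV[R]_n -> \bar R} :=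
  match n return {sigma_finite_measure set 'rV[R]_n -> \bar R} with
  | 0 => [the {sigma_finite_measure set _ -> \bar R} of \d_(0 : 'rV[R]_0)]
  | m.+1 =>
    [the {sigma_finite_measure set _ -> \bar R} of lebesgue_step (lebesgue_rV m)]
  end.

Lemma lebesgue_rV_box n (A : 'I_n -> set R) : (forall i, measurable (A i)) ->
  lebesgue_rV n [set v | forall i, A i (v 0 i)] =
  (\prod_(i < n) lebesgue_measure (A i))%E.
Proof.
elim: n A => [|n IHn] A mA.
  rewrite big_ord0 /= /dirac indicE mem_set//= => i.
  by case: i.
rewrite big_ord_recl -IHn; last by move=> i; exact: mA.
rewrite /= /lebesgue_step /pushforward -product_measure1E//.
- congr (product_measure1 _ _ _); apply/seteqP; split=> [[x v] /= Av|[x v]/= [A0 Av] i].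
    split; first by have := Av ord0; rewrite mxE unlift_none.
    by move=> i; have := Av (lift ord0 i); rewrite mxE liftK.
  by rewrite mxE; case: unliftP => [j|] -> //=.
- exact: mA.
- rewrite [X in measurable X](_ : _ = \bigcap_(i in [set: 'I_n])
      (fun v : 'rV[R]_n => v 0 i) @^-1` A (lift ord0 i)).
    apply: fin_bigcap_measurable => // i _; rewrite -[X in measurable X]setTI.
    by apply: measurable_coord => //; exact: mA.
  by apply/seteqP; split=> v /= Av i => [_|]; exact: Av.
Qed.

End lebesgue_rV.

Section domains.
Context {R : realType} {n : nat}.
Implicit Type Omega : set 'rV[R]_n.

Definition domain Omega := [/\ Omega !=set0, open Omega & connected Omega].

(* Near each boundary point, and after an orthogonal change of coordinates
   x |-> x *m Q, Omega is the strict epigraph of a Lipschitz function gamma of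
   the coordinates other than the i-th one. *)
Definition lipschitz_boundary Omega := forall p, (closure Omega `\` interior Omega) p ->
  exists (Q : 'M[R]_n) (i : 'I_n) (gamma : 'rV[R]_(n.-1) -> R),
    [/\ Q *m Q^T = 1%:M, lipschitz gamma &
        \forall x \near p, Omega x <-> gamma (col' i (x *m Q)) < (x *m Q) 0 i].

End domains.

Section sobolev.
Context {R : realType} {n : nat}.
Local Notation mu := (lebesgue_rV n).
Implicit Types (Omega : set 'rV[R]_n) (u psi : 'rV[R]_n -> R)
  (F G : 'rV[R]_n -> 'rV[R]_n).

(* Functions on Omega are represented by total functions, of which only the
   values on Omega matter; [u \_ Omega] extends u by 0. *)
Definition L2 Omega u := (u \_ Omega) \in Lfun mu 2%:E.

Definition L2v Omega F := forall i : 'I_n, L2 Omega (fun x => F x 0 i).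

Definition L2dist Omega u v : \bar R := 'N[mu]_2%:E [EFin \o ((u \- v) \_ Omega)].

Definition partial (i : 'I_n) u : 'rV[R]_n -> R :=
  fun x => 'D_(delta_mx 0 i) u x.

Definition smooth u := forall s : seq 'I_n,
  let v := foldr partial u s in
  continuous v /\ forall (i : 'I_n) x, derivable v x (delta_mx 0 i).

Definition test_function Omega psi :=
  [/\ smooth psi, compact (closure [set x | psi x != 0]) &
      closure [set x | psi x != 0] `<=` Omega].

(* "G is the gradient of u" is a relation: a weak gradient is determined only
   up to a null set. *)
Definition weak_gradient Omega u G := L2v Omega G /\
  forall psi (i : 'I_n), test_function Omega psi ->
    (\int[mu]_(x in Omega) (u x * partial i psi x)%:E =
     - \int[mu]_(x in Omega) (G x 0 i * psi x)%:E)%E.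

Definition sobolev_H1 Omega u := L2 Omega u /\ exists G, weak_gradient Omega u G.

(* The closure of the test functions in H^1(Omega). *)
Definition sobolev_H10 Omega u := sobolev_H1 Omega u /\
  exists2 G, weak_gradient Omega u G &
  exists psi : nat -> 'rV[R]_n -> R,
    [/\ forall k, test_function Omega (psi k),
        L2dist Omega (psi k) u @[k --> \oo] --> 0%E &
        forall i, L2dist Omega (partial i (psi k)) (fun x => G x 0 i)
                    @[k --> \oo] --> 0%E].

End sobolev.

Section duality.
Context {R : realType} {n : nat}.
Local Notation mu := (lebesgue_rV n).
Implicit Types (Omega : set 'rV[R]_n) (H u : 'rV[R]_n -> R)
  (F G b N : 'rV[R]_n -> 'rV[R]_n) (phi : 'rV[R]_n -> 'rV[R]_n -> R).

Definition is_norm (f : 'rV[R]_n -> R) :=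
  [/\ forall p, 0 <= f p, forall p, f p = 0 -> p = 0,
      forall a p, f (a *: p) = `|a| * f p &
      forall p q, f (p + q) <= f p + f q].

Definition dual_norm phi (x xi : 'rV[R]_n) : \bar R :=
  ereal_sup [set (dotv xi p)%:E | p in [set p | phi x p <= 1]].

(* The primal functional at u, where G is the gradient of u. *)
Definition primal_energy Omega phi F H u G : \bar R :=
  (\int[mu]_(x in Omega) (phi x (G x + F x)%R + H x * u x)%:E)%E.

Definition primal_values Omega phi F H : set (\bar R) :=
  [set e | exists u G, [/\ sobolev_H10 Omega u, weak_gradient Omega u G &
                           e = primal_energy Omega phi F H u G]].

Definition primal_inf Omega phi F H : \bar R :=
  ereal_inf (primal_values Omega phi F H).

Definition primal_minimizer Omega phi F H u G :=
  [/\ sobolev_H10 Omega u, weak_gradient Omega u G &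
      primal_energy Omega phi F H u G = primal_inf Omega phi F H].

(* The weak form of div b = H, tested against H^1_0(Omega). *)
Definition D0_tilde Omega H b := L2v Omega b /\
  forall u G, sobolev_H10 Omega u -> weak_gradient Omega u G ->
    (\int[mu]_(x in Omega) (dotv (G x) (b x) + H x * u x)%:E = 0)%E.

Definition dual_feasible Omega phi H b := D0_tilde Omega H b /\
  {ae mu, forall x, Omega x -> (dual_norm phi x (b x) <= 1)%E}.

Definition dual_value Omega F b : \bar R :=
  (\int[mu]_(x in Omega) (dotv (F x) (b x))%:E)%E.

Definition dual_sup Omega phi F H : \bar R :=
  ereal_sup [set dual_value Omega F b | b in dual_feasible Omega phi H].

End duality.

(* Main.v *)
From HB Require Import structures.
Require Import Defs.
From mathcomp Require Import all_boot all_order all_algebra.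
From mathcomp Require Import all_classical all_reals all_analysis.
From mathcomp Require Import finmap measurable_realfun ring lra.

(* On the space of integrable vector fields consider the sublinear functional
   q(v) = inf_u \int (phi(x, v + grad u) + H u); scaling u in the lower bound of
   (P') gives \int (phi(x, grad u) + H u) >= 0, so that q is finite, and q(F) is
   the infimum of (P'). By Hahn-Banach there is a linear f <= q with f(F) = q(F).
   Then f(grad u) = - \int H u, and f(v) <= \int phi(x, v) <= alpha \int |v|, so by
   Radon-Nikodym f(v) = \int N . v for a bounded N. Localizing f(v) <= \int phi(x, v)
   gives N . p <= phi(x, p) a.e., first for rational p and then for all p. The
   remaining claims follow from the fact that the duality gap of (u, b) is the
   integral of the a.e. nonnegative function
   phi(x, F + grad u) - b . (F + grad u). *)

Set Implicit Arguments.
Unset Strict Implicit.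
Unset Printing Implicit Defensive.

Import Order.TTheory GRing.Theory Num.Theory.
Import numFieldNormedType.Exports HBSimple.

Local Open Scope classical_set_scope.
Local Open Scope ring_scope.

(** * Hahn-Banach *)

(** The integrand grows only linearly in the gradient, so (P') need not attain its infimum on H^1_0,
    and N cannot be read off from the Euler-Lagrange equation of a minimizer. N comes instead from a
    subgradient at F of the value function q, which sends v to the infimum of (P') with v in place
    of F. The infimum over u built into q is what encodes the dual constraint: u itself is a
    competitor at - grad u, and using it for both u and - u turns the inequality f <= q into an
    equation for f(grad u). The L^1 bound on f dictates the space: over a set of finite measure the
    dual of L^1 is L^infinity, which is where the constraint on the dual norm puts N anyway.
    Functions are not identified when they agree almost everywhere, and integrability is a predicate
    on them; hence Hahn-Banach is set up on a subset [S] closed under linear combinations, and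
    gradients enter as pairs (u, G). *)

Section hahn_banach.
Context {R : realType} {V : lmodType R}.
Variables (S : set V) (p : V -> R).
Hypothesis S0 : S 0.
Hypothesis SL : forall a x y, S x -> S y -> S (a *: x + y).
Hypothesis pD : forall x y, S x -> S y -> p (x + y) <= p x + p y.
Hypothesis pZ : forall a x, 0 <= a -> S x -> p (a *: x) = a * p x.

Let SD x y : S x -> S y -> S (x + y).
Proof. by move=> Sx Sy; rewrite -[x]scale1r; exact: SL. Qed.

Let SZ a x : S x -> S (a *: x).
Proof. by move=> Sx; rewrite -[_ *: _]addr0; exact: SL. Qed.

(** Partial functionals are encoded as graphs so that the upper bound of a chain is a plain union.
    Being single-valued is not part of the definition: it follows from linearity and domination by
    [p]. *)
Let linear_graph (g : set (V * R)) :=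
  [/\ forall x r, g (x, r) -> S x, forall x r, g (x, r) -> r <= p x &
      forall a x r y s, g (x, r) -> g (y, s) -> g (a *: x + y, a * r + s)].

Let extend (g : set (V * R)) y c : set (V * R) :=
  [set z | exists x r a, g (x, r) /\ z = (x + a *: y, r + a * c)].

(** The value [c] at [y] must lie between every [r - p (x - y)] and every [p (x + y) - r].
    Subadditivity of [p] separates the two families, so the infimum of the upper one will do. *)
Let linear_graph_extend g y : linear_graph g -> g !=set0 -> S y ->
  exists c, linear_graph (extend g y c).
Proof.
move=> [gS gp gL] [[x0 r0] g0] Sy.
pose A := [set p (z.1 + y) - z.2 | z in g].
have lbA x r : g (x, r) -> lbound A (r - p (x - y)).
  move=> gx _ [[x' r'] /= gx'] <-; rewrite lerBlDr addrAC lerBrDr.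
  have gxx : g (x + x', r + r').
    by have := gL 1 _ _ _ _ gx gx'; rewrite scale1r mul1r.
  apply: le_trans (gp _ _ gxx) _.
  have -> : x + x' = (x' + y) + (x - y) by rewrite addrACA subrr addr0 addrC.
  apply: pD; first by apply: SD => //; exact: gS gx'.
  by apply: SD; [exact: gS gx|rewrite -scaleN1r; exact: SZ].
have A0 : A !=set0 by exists (p (x0 + y) - r0); exists (x0, r0).
have hA : has_lbound A by exists (r0 - p (x0 - y)); exact: lbA.
have infU x r : g (x, r) -> inf A <= p (x + y) - r.
  by move=> gx; apply: ge_inf => //; exists (x, r).
have infL x r : g (x, r) -> r - p (x - y) <= inf A.
  by move=> gx; apply: lb_le_inf => //; exact: lbA.
have gZ a x r : g (x, r) -> g (a *: x, a * r).
  move=> gx; have g00 : g (0, 0).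
    have := gL (-1) _ _ _ _ gx gx; by rewrite scaleN1r mulN1r !addNr.
  by have := gL a _ _ _ _ gx g00; rewrite !addr0.
exists (inf A); split.
- move=> _ _ [x [r [a [gx [-> _]]]]]; apply: SD; first exact: gS gx.
  exact: SZ.
- move=> _ _ [x [r [a [gx [-> ->]]]]].
  have Sx := gS _ _ gx.
  (* Dividing by the absolute value of [a] reduces to the lower bound on [c] if [a < 0] and to the
     upper bound if [a > 0]. *)
  have [a0|a0|->] := ltgtP a 0; last by rewrite scale0r mul0r !addr0 (gp _ _ gx).
    have na0 : 0 < - a by rewrite oppr_gt0.
    have := infL _ _ (gZ (- a)^-1 _ _ gx).
    have -> : (- a)^-1 *: x - y = (- a)^-1 *: (x + a *: y).
      by rewrite scalerDr scalerA -[in RHS](opprK a) mulrN opprK mulVf ?gt_eqF// scaleN1r.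
    rewrite pZ ?invr_ge0 ?(ltW na0)//; last by apply: SD => //; exact: SZ.
    rewrite -mulrBr ler_pdivrMl// mulNr; lra.
  have := infU _ _ (gZ a^-1 _ _ gx).
  have -> : a^-1 *: x + y = a^-1 *: (x + a *: y).
    by rewrite scalerDr scalerA mulVf ?gt_eqF// scale1r.
  rewrite pZ ?invr_ge0 ?(ltW a0)//; last by apply: SD => //; exact: SZ.
  rewrite -mulrBr ler_pdivlMl//; lra.
- move=> a _ _ _ _ [x [r [b [gx [-> ->]]]]] [x' [r' [b' [gx' [-> ->]]]]].
  exists (a *: x + x'), (a * r + r'), (a * b + b'); split; first exact: gL.
  congr pair; last by ring.
  by rewrite scalerDr scalerDl scalerA addrACA.
Qed.

Lemma hahn_banach x0 : S x0 -> exists f : V -> R,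
  [/\ forall a x y, S x -> S y -> f (a *: x + y) = a * f x + f y,
      forall x, S x -> f x <= p x & f x0 = p x0].
Proof.
move=> Sx0.
have p0 : p 0 = 0 by rewrite -(scale0r 0) pZ// mul0r.
(* The prescribed value at [x0] is required only of nonempty graphs, so that the union of the empty
   chain qualifies for Zorn's lemma. *)
pose P (g : set (V * R)) := linear_graph g /\ (g !=set0 -> g (x0, p x0)).
have [|g [[[gS gp gL] g0] gmax]] := @Zorn_bigcup _ P.
  move=> Q QP Qtot; split; [split|].
  - by move=> x r [g Qg gx]; have [[gS _ _] _] := QP _ Qg; exact: gS gx.
  - by move=> x r [g Qg gx]; have [[_ gp _] _] := QP _ Qg; exact: gp gx.
  - move=> a x r y s [g Qg gx] [h Qh hy].
    have [gh|hg] := Qtot _ _ Qg Qh.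
      by exists h => //; have [[_ _ +] _] := QP _ Qh; apply => //; exact: gh.
    by exists g => //; have [[_ _ +] _] := QP _ Qg; apply => //; exact: hg.
  - move=> [z [g Qg gz]]; exists g => //; have [_] := QP _ Qg; apply.
    by exists z.
have {}g0 : g (x0, p x0).
  apply: contrapT => ng0.
  have gE : g = set0.
    by apply/eqP; apply: contrapT => /negP/set0P /g0.
  (* An empty maximal graph would be enlarged by the line through [x0]. For [a < 0] the domination
     there comes from [0 = p 0 <= p (a *: x0) + p (- a *: x0)]. *)
  apply: (gmax [set z | exists a, z = (a *: x0, a * p x0)]).
    rewrite gE properEneq; split => //; apply/eqP => /esym/eqP; apply/negP/set0P.
    by exists (0 *: x0, 0 * p x0), 0.
  split; last by move=> _; exists 1; rewrite scale1r mul1r.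
  split.
  - by move=> _ _ [a [-> _]]; exact: SZ.
  - move=> _ _ [a [-> ->]]; have [a0|a0] := leP 0 a; first by rewrite pZ.
    have := pD (SZ a Sx0) (SZ (- a) Sx0).
    by rewrite scaleNr subrr p0 -scaleNr [p (- a *: _)]pZ ?oppr_ge0 ?(ltW a0)// mulNr subr_ge0.
  - move=> a _ _ _ _ [b [-> ->]] [c [-> ->]]; exists (a * b + c).
    by rewrite scalerDl scalerA; congr pair; ring.
have g00 : g (0, 0).
  by have := gL (-1) _ _ _ _ g0 g0; rewrite scaleN1r mulN1r !addNr.
have gtot y : S y -> exists r, g (y, r).
  move=> Sy; apply: contrapT => ny.
  have gn0 : g !=set0 by exists (x0, p x0).
  have [c gc] := linear_graph_extend (And3 gS gp gL) gn0 Sy.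
  have sub : g `<=` extend g y c.
    by move=> [x r] gx; exists x, r, 0; rewrite scale0r mul0r !addr0.
  apply: (gmax (extend g y c)); last by split => // _; exact: sub.
  split => // /(_ (y, c)) gy; apply: ny; exists c; apply: gy.
  by exists 0, 0, 1; rewrite scale1r mul1r !add0r.
(* Both [(0, s - r)] and [(0, r - s)] lie in [g], and [p 0 = 0] bounds them from above. *)
have guniq y r s : g (y, r) -> g (y, s) -> r = s.
  move=> gr gs; have := gL (-1) _ _ _ _ gr gs; have := gL (-1) _ _ _ _ gs gr.
  rewrite !scaleN1r !mulN1r addNr => /gp + /gp; rewrite p0; lra.
pose f y := if pselect (S y) is left Sy then sval (cid (gtot y Sy)) else 0.
have fg y : S y -> g (y, f y).
  by rewrite /f; case: pselect => // Sy _; case: cid.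
exists f; split.
- move=> a x y Sx Sy; apply: guniq (fg _ _) _; first exact: SL.
  by apply: gL; exact: fg.
- by move=> x Sx; apply: gp; exact: fg.
- exact: guniq (fg _ Sx0) g0.
Qed.

End hahn_banach.

(** * Bounded functionals on integrable functions *)

(** On the set where [h < f] the hypothesis and the pointwise order force equal integrals over every
    measurable subset. Hence [f = h] a.e. there, and the set is null. *)
Lemma ae_le_of_integral_le d (T : measurableType d) (R : realType)
    (mu : {measure set T -> \bar R}) (D : set T) (f h : T -> R) :
  measurable D -> mu.-integrable D (EFin \o f) -> mu.-integrable D (EFin \o h) ->
  (forall E, E `<=` D -> measurable E ->
     \int[mu]_(x in E) f x <= \int[mu]_(x in E) h x) ->
  {ae mu, forall x, D x -> f x <= h x}.
Proof.
move=> mD intf inth fh.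
pose A := D `&` [set x | h x < f x].
have mA : measurable A.
  rewrite (_ : A = D `&` [set x | ((EFin \o h) x < (EFin \o f) x)%E]).
    by apply: measurable_lte => //; [exact: measurable_int inth|exact: measurable_int intf].
  by apply/seteqP; split => x; rewrite /A/= lte_fin.
have AD : A `<=` D by move=> x [].
have intS (E : set T) (k : T -> R) : E `<=` D -> measurable E ->
    mu.-integrable D (EFin \o k) -> mu.-integrable E (EFin \o k).
  by move=> ED mE; exact: integrableS.
have eqA : ae_eq mu A (EFin \o f) (EFin \o h).
  apply: integral_ae_eq => //; first exact: intS.
    by apply: (measurable_int mu); exact: intS inth.
  move=> E EA mE; have ED := subset_trans EA AD.
  have /integrable_fin_num ff := intS _ _ ED mE intf.
  have /integrable_fin_num hh := intS _ _ ED mE inth.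
  rewrite -[LHS]fineK ?ff// -[RHS]fineK ?hh//; congr EFin.
  apply/eqP; rewrite eq_le (fh _ ED mE)/=.
  apply: le_Rintegral => //; [exact: intS|exact: intS|].
  by move=> x /EA[_ /ltW].
apply: filterS eqA => x /= fhx Dx; rewrite leNgt; apply/negP => hf.
by have [] := fhx (conj Dx hf) => fE; move: hf; rewrite fE ltxx.
Qed.

Section integrable_functional.
Context d (T : measurableType d) (R : realType).
Variables (mu : {measure set T -> \bar R}) (D : set T).
Hypothesis mD : measurable D.
Local Notation L1 w := (mu.-integrable D (EFin \o w)).

Lemma L1_lin (a : R) (v w : T -> R) : L1 v -> L1 w ->
  L1 (fun x => a * v x + w x).
Proof.
move=> iv iw; rewrite (_ : _ \o _ = (fun x => a%:E * (v x)%:E + (w x)%:E)%E)//.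
by apply: integrableD => //; exact: integrableZl.
Qed.

Lemma L1_indic (A : set T) : (mu D < +oo)%E -> measurable A -> L1 (\1_A).
Proof.
move=> muD mA; apply: (@measurable_bounded_integrable _ _ _ _ (\1_A)) => //.
exists 1; split => // M M1 x _ /=; rewrite indicE ger0_norm//.
by apply: le_trans (ltW M1); case: (_ \in _).
Qed.

Lemma L1_bounded_mul (C : R) (N w : T -> R) : measurable_fun D N ->
  (forall x, `|N x| <= C) -> L1 w -> L1 (fun x => N x * w x).
Proof.
move=> mN NC iw; have mw : measurable_fun D w.
  by apply/measurable_EFinP; exact: measurable_int iw.
apply: (@le_integrable _ _ _ _ _ mD _ (fun x => C%:E * (w x)%:E)%E).
- by apply/measurable_EFinP; exact: measurable_funM.
- move=> x _ /=; rewrite lee_fin !normrM ler_wpM2r//.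
  exact: le_trans (NC x) (ler_norm _).
- exact: integrableZl.
Qed.

Section zero.
Variables (h : (T -> R) -> R) (C : R).
Hypothesis muD : (mu D < +oo)%E.
Hypothesis h_lin : forall a v w, L1 v -> L1 w ->
  h (fun x => a * v x + w x) = a * h v + h w.
Hypothesis h_le : forall w, L1 w -> h w <= C * \int[mu]_(x in D) `|w x|.

Let L10 : L1 (fun=> 0).
Proof. by rewrite (_ : _ \o _ = cst 0%E)//; exact: integrable0. Qed.

Lemma functional0 : h (fun=> 0) = 0.
Proof.
have := h_lin 1 L10 L10.
rewrite (_ : (fun=> _) = (fun=> 0 : R)); last by apply/funext => x; lra.
lra.
Qed.

Lemma functionalB v w : L1 v -> L1 w -> h (fun x => v x - w x) = h v - h w.
Proof.
move=> iv iw; rewrite (_ : (fun x => _) = (fun x => (-1) * w x + v x)).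
  by rewrite h_lin//; lra.
by apply/funext => x; lra.
Qed.

(** A linear functional is odd, so the one-sided bound applied to [- v] gives the other side. This
    is why a bound by a sublinear functional suffices later on. *)
Lemma functional_norm_le v : L1 v -> `|h v| <= C * \int[mu]_(x in D) `|v x|.
Proof.
move=> iv; rewrite ler_norml h_le// andbT.
have iNv : L1 (fun x => (-1) * v x + 0) by exact: L1_lin.
have := h_le iNv; rewrite h_lin// functional0 addr0.
rewrite (@eq_Rintegral _ _ _ _ _ (fun x => `|v x|)); first by move=> ?; lra.
by move=> x _; rewrite addr0 mulN1r normrN.
Qed.

Lemma functional_sum n (a : 'I_n -> R) (v : 'I_n -> T -> R) :
  (forall i, L1 (v i)) ->
  L1 (fun x => \sum_(i < n) a i * v i x) /\
  h (fun x => \sum_(i < n) a i * v i x) = \sum_(i < n) a i * h (v i).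
Proof.
elim: n a v => [|n IH] a v iv.
  rewrite big_ord0 (_ : (fun x => _) = (fun=> 0 : R)); first by split; [|exact: functional0].
  by apply/funext => x; rewrite big_ord0.
rewrite (_ : (fun x => _) = (fun x => a ord0 * v ord0 x +
   \sum_(i < n) a (lift ord0 i) * v (lift ord0 i) x)); last first.
  by apply/funext => x; rewrite big_ord_recl.
have [ir hr] := IH (fun i => a (lift ord0 i)) _ (fun i => iv (lift ord0 i)).
split; first exact: L1_lin.
by rewrite h_lin// hr big_ord_recl.
Qed.

(** Simple functions are dense in L^1, [h] vanishes on them by linearity, and [functional_norm_le]
    makes [h] continuous. *)
Lemma functional_eq0 : (forall A, measurable A -> h (\1_A) = 0) ->
  forall w, L1 w -> h w = 0.
Proof.
move=> h1 w iw.
have [g_ [ig _ gw]] := approximation_sfun_integrable mD iw.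
have hg n : h (g_ n) = 0.
  pose g : T -> R := g_ n; pose y := fset_set (range g).
  rewrite (_ : _ (g_ n) = fun x => \sum_(i < #|`y|) y`_i * \1_(g @^-1` [set y`_i]) x).
    have [|_ ->] := @functional_sum _ (fun i : 'I_(#|`y|) => y`_i)
        (fun i => \1_(g @^-1` [set y`_i])).
      by move=> i; apply: L1_indic => //; exact: measurable_sfunP.
    by rewrite big1// => i _; rewrite h1 ?mulr0//; exact: measurable_sfunP.
  by apply/funext => x; exact: fimfunEord.
have hw n : (`|h w|%:E <= C%:E * \int[mu]_(x in D) `|(w x)%:E - (g_ n x)%:E|)%E.
  have igw : L1 (fun x => w x - g_ n x).
    rewrite (_ : _ \o _ = (fun x => (w x)%:E - (g_ n x)%:E)%E)//.
    exact: (integrableB mD iw (ig n)).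
  have := functional_norm_le igw; rewrite functionalB// hg subr0 -lee_fin => /le_trans.
  apply; rewrite EFinM [X in (_ * X <= _)%E]fineK; first by apply: lexx.
  by apply: integrable_fin_num => //; exact: integrable_norm.
apply/eqP; rewrite -normr_le0 -lee_fin.
apply: (@le_trans _ _ (C%:E * 0)%E); last by rewrite mule0.
have cgw := cvgeZl (isT : C%:E \is a fin_num) gw.
rewrite -(cvg_lim _ cgw)//; apply: lime_ge.
  by apply/cvg_ex; exists (C%:E * 0)%E; exact: cgw.
by apply: nearW => n; exact: hw.
Qed.

End zero.

End integrable_functional.

(** * Representation of bounded functionals on L^1 by bounded functions *)

Section riesz.
Context d (T : measurableType d) (R : realType).
Variables (mu : {sigma_finite_measure set T -> \bar R}) (D : set T).
Hypotheses (mD : measurable D) (muD : (mu D < +oo)%E).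
Local Notation L1 w := (mu.-integrable D (EFin \o w)).
Variables (g : (T -> R) -> R) (C : R).
Hypothesis C0 : 0 <= C.
Hypothesis g_lin : forall a v w, L1 v -> L1 w ->
  g (fun x => a * v x + w x) = a * g v + g w.
Hypothesis g_le : forall w, L1 w -> g w <= C * \int[mu]_(x in D) `|w x|.

Let nu (A : set T) : \bar R := (g (\1_A))%:E.

Let m := mrestr mu mD.

Let m_fin A : measurable A -> m A \is a fin_num.
Proof.
move=> mA; rewrite ge0_fin_numE// (le_lt_trans _ muD)//.
exact: measureIr.
Qed.

Let nu_le A : measurable A -> (`|nu A| <= C%:E * m A)%E.
Proof.
move=> mA; rewrite /nu abse_EFin -[m A]fineK ?m_fin// -EFinM lee_fin.
have -> : fine (m A) = \int[mu]_(x in D) `|\1_A x|.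
  rewrite /m /mrestr -(integral_indic mu mD mA); congr fine.
  by apply: eq_integral => x _; rewrite ger0_norm.
by apply: (functional_norm_le mD g_lin g_le); exact: L1_indic.
Qed.

Let nu0 : nu set0 = 0%E.
Proof. by rewrite /nu indic0 (functional0 g_lin). Qed.

Let nuU A B : measurable A -> measurable B -> A `&` B = set0 ->
  nu (A `|` B) = (nu A + nu B)%E.
Proof.
move=> mA mB AB; rewrite /nu -EFinD; congr EFin.
have -> : \1_(A `|` B) = (fun x => 1 * \1_A x + \1_B x) :> (T -> R).
  apply/funext => x; rewrite mul1r !indicE in_setU.
  have [xA|xA] := boolP (x \in A); have [xB|xB] := boolP (x \in B);
    rewrite ?addr0 ?add0r//=.
  have : (A `&` B) x by split; exact: set_mem.
  by rewrite AB.
by rewrite g_lin ?mul1r//; exact: L1_indic.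
Qed.

(** Finite additivity plus continuity at the empty set: the tails [W n] decrease to the empty set,
    [m] is finite, and [nu_le] carries [m (W n) --> 0] over to [nu]. *)
Let nu_sigma_additive : semi_sigma_additive nu.
Proof.
move=> F mF tF mUF.
pose U n := \big[setU/set0]_(i < n) F i.
have mU n : measurable (U n) by exact: bigsetU_measurable.
have nuE n : (\sum_(0 <= i < n) nu (F i) = nu (U n))%E.
  rewrite big_mkord /U; elim: n => [|n IH]; first by rewrite !big_ord0 nu0.
  rewrite !big_ord_recr/= IH (nuU (mU n) (mF n))//.
  rewrite /U -bigcup_mkord -subset0 => x [[i /= ni Fi] Fn].
  have iE : i = n by apply: tF => //; exists x.
  by move: ni; rewrite iE ltnn.
under eq_fun do rewrite nuE.
pose W n := \bigcup_n F n `\` U n.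
have mW n : measurable (W n) by exact: measurableD.
have UE n : (nu (\bigcup_n F n) - nu (U n) = nu (W n))%E.
  have UW : U n `|` W n = \bigcup_n F n.
    rewrite /W setDE setUIr setUv setIT; apply/setUidPr.
    by rewrite /U -bigcup_mkord; apply: bigcup_subset.
  rewrite -[in LHS]UW (nuU (mU n) (mW n)); first by rewrite addeAC subee// add0e.
  by rewrite /W setDE setICA setICr setI0.
have Wcvg : m (W n) @[n --> \oo] --> 0%E.
  rewrite -(measure0 m).
  have -> : set0 = \bigcap_n W n.
    apply/esym; rewrite -subset0 => x Wx.
    have [[i _ Fi] _] := Wx 0%N I; have [_] := Wx i.+1 I; apply.
    by rewrite /U -bigcup_mkord; exists i => /=.
  apply: nonincreasing_cvg_mu => //.
  - by rewrite ltey_eq m_fin.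
  - exact: bigcapT_measurable.
  - move=> i j ij; apply/subsetPset => x [Fx Ux]; split => //.
    by apply: contra_not Ux; apply/subset_bigsetU.
have CW : (C%:E * m (W n))%E @[n --> \oo] --> 0%E.
  by rewrite -(mule0 C%:E); exact: cvgeZl.
have nuW : nu (W n) @[n --> \oo] --> 0%E.
  apply: (@squeeze_cvge _ _ _ _ (fun n => - (C%:E * m (W n)))%E _
                                (fun n => C%:E * m (W n))%E) => //.
    apply: nearW => n; have := nu_le (mW n).
    by rewrite -[m _]fineK ?m_fin// -!EFinM !lee_fin -ler_norml.
  by rewrite -oppe0; exact: cvgeN.
rewrite (_ : (fun n => nu (U n)) = (fun n => nu (\bigcup_n F n) - nu (W n))%E); last first.
  by apply/funext => n; rewrite -UE oppeB// addeA subee// add0e.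
suff : (nu (\bigcup_n F n) - nu (W n))%E @[n --> \oo] --> (nu (\bigcup_n F n) - 0)%E.
  by rewrite sube0.
by apply: cvgeB => //; exact: cvg_cst.
Qed.

Lemma L1_riesz : exists N : T -> R,
  [/\ measurable_fun [set: T] N, forall x, `|N x| <= C &
      forall w, L1 w -> g w = \int[mu]_(x in D) (N x * w x)].
Proof.
have nu_fin A : measurable A -> nu A \is a fin_num by [].
pose nuc : {charge set T -> \bar R} :=
  HB.pack nu (isCharge.Build _ _ _ nu nu0 nu_fin nu_sigma_additive).
have dom : nuc `<< mu.
  apply/null_content_dominatesP => A mA muA0.
  have mA0 : m A = 0%E.
    by apply/eqP; rewrite -measure_le0 -muA0 measureIl.
  have := nu_le mA; rewrite mA0 mule0 /nu abse_EFin lee_fin normr_le0 => /eqP gA.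
  by rewrite /= /nu gA.
pose N0 := fine \o Radon_Nikodym nuc mu.
have N0E : EFin \o N0 = Radon_Nikodym nuc mu.
  by apply/funext => x; rewrite /N0/= fineK// Radon_Nikodym_fin_num.
have iN0 : mu.-integrable setT (EFin \o N0).
  by rewrite N0E; exact: Radon_Nikodym_integrable.
have iN0D : L1 N0 by exact: integrableS iN0.
have gN0 A : measurable A -> g (\1_A) = \int[mu]_(x in A) N0 x.
  move=> mA; rewrite /Rintegral.
  rewrite (_ : (\int[mu]_(x in A) (N0 x)%:E)%E = nu A)//.
  rewrite -[RHS]/(nuc A) (Radon_Nikodym_integral dom mA).
  by apply: eq_integral => x _; rewrite -N0E.
have icst c : L1 (cst c).
  apply: measurable_bounded_integrable => //; exists `|c|; split => // M cM x _ /=.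
  exact: ltW.
have bnd E : E `<=` D -> measurable E -> `|\int[mu]_(x in E) N0 x| <= \int[mu]_(x in E) C.
  move=> ED mE; have := nu_le mE; rewrite -gN0//.
  have muE : mu E \is a fin_num by rewrite -(setIidl ED); exact: m_fin.
  by rewrite Rintegral_cst// /nu /m /mrestr (setIidl ED) -[mu E]fineK// -EFinM lee_fin.
have leC : {ae mu, forall x, D x -> N0 x <= C}.
  apply: (ae_le_of_integral_le mD iN0D (icst C)) => E ED mE.
  by have := bnd _ ED mE; rewrite ler_norml => /andP[].
have geC : {ae mu, forall x, D x -> - C <= N0 x}.
  apply: (ae_le_of_integral_le mD (icst (- C)) iN0D) => E ED mE.
  have := bnd _ ED mE; rewrite ler_norml => /andP[+ _]; apply: le_trans.
  by rewrite !Rintegral_cst// mulNr.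
(* Almost everywhere on [D] the truncation changes nothing; it upgrades the a.e. bound to a bound at
   every point. *)
pose N x := Num.max (- C) (Num.min C (N0 x)).
have mN0 : measurable_fun setT N0 by apply/measurable_EFinP; exact: measurable_int iN0.
have mN : measurable_fun setT N.
  by apply: measurable_maxr => //; exact: measurable_minr.
have NC x : `|N x| <= C.
  rewrite ler_norml /N le_max lexx/= ge_max ge_min lexx/= andbT.
  by rewrite lerNl (le_trans _ C0)// oppr_le0.
have mND : measurable_fun D N by exact: measurable_funTS.
exists N; split => // w iw; apply/eqP; rewrite -subr_eq0; apply/eqP.
have iNw v : L1 v -> L1 (fun x => N x * v x) by exact: L1_bounded_mul NC.
(* The difference of the two sides is linear and vanishes on indicators. Its constant is [C + C]
   because [g] and the integral against [N] contribute [C] each. *)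
apply: (@functional_eq0 _ _ _ mu D mD
  (fun v => g v - \int[mu]_(x in D) (N x * v x)) (C + C)) => //.
- move=> a v1 v2 i1 i2; rewrite g_lin//.
  rewrite (@eq_Rintegral _ _ _ _ _ (fun x => a * (N x * v1 x) + N x * v2 x)); last first.
    by move=> x _; ring.
  rewrite RintegralD//; [|exact: (@integrableZl _ _ _ _ _ mD _ _ (iNw _ i1))|exact: iNw].
  by rewrite RintegralZl//; [ring|exact: iNw].
- move=> v iv; rewrite mulrDl lerD ?g_le//.
  have inv : L1 (fun x => `|v x|) by exact: integrable_norm.
  apply: le_trans (ler_norm _) _; rewrite normrN.
  apply: le_trans (le_normr_Rintegral _ _) _ => //; first exact: iNw.
  rewrite -RintegralZl//; apply: le_Rintegral => //.
  - by apply: integrable_norm; exact: iNw.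
  - exact: (@integrableZl _ _ _ _ _ mD _ _ inv).
  - by move=> x _; rewrite normrM ler_wpM2r.
- move=> A mA.
  have mDA := measurableI _ _ mD mA.
  (* [g] acts on functions defined on all of [T]; the part of [A] outside [D] contributes 0 because
     it is null for [m]. *)
  have -> : g (\1_A) = g (\1_(D `&` A)).
    apply: EFin_inj; rewrite -[LHS]/(nu A) -[RHS]/(nu _).
    have mAD := measurableD mA mD.
    have AE : A = (D `&` A) `|` (A `\` D) by rewrite setIC setUIDK.
    rewrite {1}AE nuU//; last by rewrite -subset0 => x [[Dx _] [_ /(_ Dx)]].
    suff -> : nu (A `\` D) = 0%E by rewrite adde0.
    have := nu_le mAD; rewrite /m /mrestr setDE -setIA setICl setI0 measure0.
    by rewrite mule0 /nu abse_EFin lee_fin normr_le0 => /eqP ->.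
  rewrite gN0//.
  have -> : \int[mu]_(x in D) (N x * \1_A x) = \int[mu]_(x in D `&` A) N x.
    rewrite Rintegral_mkcondr; apply: eq_Rintegral => x _.
    by rewrite patchE indicE; case: ifP => _ /=; rewrite ?mulr1 ?mulr0.
  apply/eqP; rewrite subr_eq0; apply/eqP; congr fine.
  apply: ae_eq_integral => //.
  - by apply/measurable_EFinP; exact: measurable_funTS.
  - by apply/measurable_EFinP; exact: measurable_funTS.
  - apply: filterS2 leC geC => x /= le ge [Dx Ax]; rewrite /N.
    by rewrite (min_idPr (le Dx)) (max_idPr (ge Dx)).
Qed.

End riesz.

(** * Measurability on R^n *)

Section euclidean_measurable.
Context {R : realType} {n : nat}.
Implicit Types (Omega : set 'rV[R]_n) (v p q : 'rV[R]_n).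

Lemma rV_ratr_approx v (e : R) : 0 < e ->
  exists q : 'rV[rat]_n, forall i, `|v 0 i - ratr (q 0 i)| < e.
Proof.
move=> e0.
have H i : exists q : rat, `|v 0 i - ratr q| < e.
  have /rat_in_itvoo[q] : v 0 i - e < v 0 i + e by lra.
  rewrite in_itv/= => /andP[ql qr]; exists q; rewrite ltr_norml; lra.
exists (\row_i sval (cid (H i))) => i; rewrite mxE.
by case: cid.
Qed.

Lemma rV_ratr_approx_l1 v (e : R) : 0 < e ->
  exists q : 'rV[rat]_n, \sum_i `|v 0 i - ratr (q 0 i)| < e.
Proof.
(* Precision [e / n.+1] in each of the [n] coordinates keeps the total strictly below [e] and covers
   [n = 0]. *)
move=> e0; have n0 : 0 < n.+1%:R :> R by rewrite ltr0n.
have [q vq] := rV_ratr_approx v (divr_gt0 e0 n0).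
exists q; apply: (@le_lt_trans _ _ (n%:R * (e / n.+1%:R))).
  move: (e / _) vq => d vq; rewrite mulr_natl -[n in X in _ <= X]card_ord -sumr_const.
  by apply: ler_sum => i _; exact: ltW.
by rewrite mulrCA gtr_pMr// ltr_pdivrMr// mul1r ltr_nat.
Qed.

Lemma measurable_rV_box (A : 'I_n -> set R) : (forall i, measurable (A i)) ->
  measurable [set v : 'rV[R]_n | forall i, A i (v 0 i)].
Proof.
move=> mA; rewrite [X in measurable X](_ : _ = \bigcap_(i in [set: 'I_n])
    (fun v : 'rV[R]_n => v 0 i) @^-1` A i).
  apply: fin_bigcap_measurable => // i _; rewrite -[X in measurable X]setTI.
  exact: measurable_coord.
by apply/seteqP; split=> v /= Av i => [_|]; exact: Av.
Qed.

(** The sigma-algebra is generated by the coordinates, not by the topology; the link is that an open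
    set is the countable union of the rational boxes it contains. *)
Lemma open_measurable_rV Omega : open Omega -> measurable Omega.
Proof.
move=> oO.
pose box (z : 'rV[rat]_n * nat) : set 'rV[R]_n :=
  [set v | forall i, ball (ratr (z.1 0 i) : R) z.2.+1%:R^-1 (v 0 i)].
pose F z := if `[< box z `<=` Omega >] then box z else set0.
have -> : Omega = \bigcup_z F z.
  apply/seteqP; split => [v Ov|v [z _]]; last first.
    by rewrite /F; case: asboolP => // + bv; exact.
  have /nbhs_ballP[e /= e0 eO] : nbhs v Omega by move: oO; rewrite openE; exact.
  (* Half of [e], because [v] and an arbitrary point of the box are each compared with its
     centre. *)
  have [k _ ke] : exists2 k, True & k.+1%:R^-1 < e / 2.
    have /ltr_add_invr[k] : 0 < e / 2 by rewrite divr_gt0.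
    by rewrite add0r => ke; exists k.
  have k0 : 0 < k.+1%:R^-1 :> R by rewrite invr_gt0.
  have [q vq] := rV_ratr_approx v k0.
  exists (q, k) => //; rewrite /F; case: asboolP => [_ i|].
    by rewrite /= /ball/= distrC.
  case=> w bw; apply: eO; split => // i j; rewrite ord1.
  have := bw j; have := vq j; rewrite /= /ball/=.
  move: (k.+1%:R^-1) ke => r re h1 h2.
  rewrite (_ : v 0 j - w 0 j = (v 0 j - ratr (q 0 j)) + (ratr (q 0 j) - w 0 j)); last by lra.
  by apply: le_lt_trans (ler_normD _ _) _; lra.
apply: countable_bigcupT_measurable; first exact: countableP.
move=> z; rewrite /F; case: asboolP => // _.
by apply: (@measurable_rV_box (fun i => ball _ _)) => i; exact: measurable_ball.
Qed.

Lemma continuous_measurable_rV Omega (f : 'rV[R]_n -> R) : open Omega ->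
  {in Omega, continuous f} -> measurable_fun Omega f.
Proof.
move=> oO /(continuous_inP _ oO) cf.
apply: (measurability _ (RGenOpens.measurableE R)).
move=> _ [_ [a [b ->] <-]]; apply: open_measurable_rV; apply: cf.
exact: interval_open.
Qed.

Lemma bounded_lebesgue_rV_lty Omega : measurable Omega -> bounded_set Omega ->
  (lebesgue_rV n Omega < +oo)%E.
Proof.
move=> mO [M [_ /(_ (`|M| + 1))]].
rewrite (le_lt_trans (ler_norm _)) ?ltrDl// => /(_ isT) OM.
pose K := `|M| + 1.
have mK (i : 'I_n) : measurable (`[- K, K] : set R) by [].
pose B := [set v : 'rV[R]_n | forall i : 'I_n, `[- K, K]%classic (v 0 i)].
have OB : Omega `<=` B.
  move=> v /OM vK i; rewrite /= in_itv/= -ler_norml.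
  apply: le_trans vK; rewrite [leRHS]mx_normrE.
  exact: (le_bigmax _ (fun ij : 'I_1 * 'I_n => `|v ij.1 ij.2|) (0, i)).
apply: (le_lt_trans (le_measure _ (mem_set mO) (mem_set (measurable_rV_box mK)) OB)).
rewrite [ltLHS](lebesgue_rV_box mK) ltey_eq; apply/orP; left; apply: prode_fin_num => i _.
by rewrite lebesgue_measure_itv/=; case: ifP.
Qed.

Lemma is_norm_sum (f : 'rV[R]_n -> R) (m : nat) (p : 'I_m -> 'rV[R]_n) : is_norm f ->
  f (\sum_(i < m) p i) <= \sum_(i < m) f (p i).
Proof.
move=> [f0 _ fZ fD]; elim: m p => [|m IH] p.
  by rewrite !big_ord0 -(scale0r 0) fZ normr0 mul0r.
rewrite !big_ord_recr/=; apply: le_trans (fD _ _) _.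
by rewrite lerD2r.
Qed.

Lemma enorm_delta i : enorm (delta_mx 0 i : 'rV[R]_n) = 1.
Proof.
rewrite /enorm /dotv (bigD1 i)//= mxE !eqxx mul1r big1 ?addr0 ?sqrtr1//.
by move=> j ji; rewrite mxE eqxx (negbTE ji) mul0r.
Qed.

Lemma is_norm_le_l1 (f : 'rV[R]_n -> R) (alpha : R) p : is_norm f ->
  (forall xi, f xi <= alpha * enorm xi) -> f p <= alpha * \sum_i `|p 0 i|.
Proof.
move=> nf fa; rewrite {1}(row_sum_delta p); apply: le_trans (is_norm_sum _ nf) _.
rewrite mulr_sumr; apply: ler_sum => i _; have [_ _ fZ _] := nf.
rewrite fZ mulrC ler_wpM2r//.
by apply: le_trans (fa _) _; rewrite enorm_delta mulr1.
Qed.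

(** Expanding in the standard basis bounds [f] by [alpha] times the l^1 norm. This Lipschitz
    estimate, uniform in the base point, is what allows passing from rational vectors to all
    vectors. *)
Lemma is_norm_lip (f : 'rV[R]_n -> R) (alpha : R) p q : is_norm f ->
  (forall xi, f xi <= alpha * enorm xi) ->
  f p <= f q + alpha * \sum_i `|p 0 i - q 0 i|.
Proof.
move=> nf fa; rewrite -{1}(subrK q p) addrC.
have [_ _ _ fD] := nf; apply: le_trans (fD _ _) _; rewrite lerD2l.
apply: le_trans (is_norm_le_l1 _ nf fa) _.
by rewrite le_eqVlt; apply/orP; left; apply/eqP; congr (_ * _);
   apply: eq_bigr => i _; rewrite !mxE.
Qed.

Lemma dotv_le_l1 (C : R) p q : (forall i, `|p 0 i| <= C) ->
  dotv p q <= C * \sum_i `|q 0 i|.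
Proof.
move=> pC; rewrite mulr_sumr; apply: ler_sum => i _.
by apply: le_trans (ler_norm _) _; rewrite normrM ler_wpM2r.
Qed.

Lemma dotvDr p q v : dotv p (q + v) = dotv p q + dotv p v.
Proof. by rewrite -big_split/=; apply: eq_bigr => i _; rewrite mxE mulrDr. Qed.

Lemma dotv_le_norm_of_rat (f : 'rV[R]_n -> R) (alpha C : R) q : 0 < alpha ->
  is_norm f -> (forall xi, f xi <= alpha * enorm xi) ->
  (forall i, `|q 0 i| <= C) ->
  (forall r : 'rV[rat]_n, dotv q (map_mx ratr r) <= f (map_mx ratr r)) ->
  forall xi, dotv q xi <= f xi.
Proof.
move=> a0 nf fa qC qf xi; apply/ler_addgt0Pr => e e0.
have aC0 : 0 < alpha + `|C| by rewrite ltr_pwDl.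
(* The sum of the Lipschitz constants of the two sides, [alpha] for [f] and the absolute value of
   [C] for [dotv q], turns this precision into a total error below [e]. *)
have [r] := rV_ratr_approx_l1 xi (divr_gt0 e0 aC0).
rewrite ltr_pdivlMr// => re; set s := map_mx ratr r : 'rV[R]_n.
have sE : \sum_i `|s 0 i - xi 0 i| = \sum_i `|xi 0 i - ratr (r 0 i)|.
  by apply: eq_bigr => i _; rewrite /s mxE distrC.
have := is_norm_lip s xi nf fa; rewrite sE.
have : dotv q (xi - s) <= `|C| * \sum_i `|xi 0 i - ratr (r 0 i)|.
  have qC' i : `|q 0 i| <= `|C| by apply: le_trans (qC i) (ler_norm _).
  apply: le_trans (dotv_le_l1 _ qC') _.
  rewrite le_eqVlt; apply/orP; left; apply/eqP; congr (_ * _).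
  by apply: eq_bigr => i _; rewrite !mxE.
have := qf r; rewrite -/s => qs.
have -> : dotv q xi = dotv q s + dotv q (xi - s) by rewrite -dotvDr subrKC.
by move: re; rewrite mulrDr; lra.
Qed.

Lemma dotvZr a p q : dotv p (a *: q) = a * dotv p q.
Proof. by rewrite mulr_sumr; apply: eq_bigr => i _; rewrite mxE; ring. Qed.

Lemma dotvC p q : dotv p q = dotv q p.
Proof. by apply: eq_bigr => i _; rewrite mulrC. Qed.

Section integrand.
Variables (Omega : set 'rV[R]_n) (phi : 'rV[R]_n -> 'rV[R]_n -> R) (alpha : R).
Hypothesis oO : open Omega.
Hypothesis phi_cont : {within Omega `*` setT, continuous
                 (fun z : 'rV[R]_n * 'rV[R]_n => phi z.1 z.2)}.
Hypothesis alpha0 : 0 < alpha.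
Hypothesis phi_alpha : forall x xi, Omega x -> phi x xi <= alpha * enorm xi.
Hypothesis phi_norm : forall x, Omega x -> is_norm (phi x).

Lemma measurable_integrand_cst q : measurable_fun Omega (phi^~ q).
Proof.
apply: continuous_measurable_rV => // x /set_mem Ox.
have oOT : open (Omega `*` setT : set ('rV[R]_n * 'rV[R]_n)).
  rewrite openE => -[y z] [/= Oy _]; exists (Omega, setT) => //=; split.
    exact: open_nbhs_nbhs.
  exact: filterT.
move: phi_cont; rewrite continuous_open_subspace// => /(_ (x, q)).
move=> /(_ (mem_set (conj Ox I))) cphi.
apply: (@continuous_comp _ _ _ (fun x => (x, q))
  (fun z : 'rV[R]_n * 'rV[R]_n => phi z.1 z.2)) => //.
move=> B [[P Q] [/= nP nQ] PQB]; apply: filterS nP => y Py.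
by apply: PQB; split => //; exact: nbhs_singleton nQ.
Qed.

(** By the Lipschitz estimate, [phi x (v x)] is the infimum over rational [q] of the measurable
    functions [h q], so its strict sublevel sets are countable unions of theirs. *)
Lemma measurable_integrand (v : 'rV[R]_n -> 'rV[R]_n) :
  (forall i, measurable_fun Omega (fun x => v x 0 i)) ->
  measurable_fun Omega (fun x => phi x (v x)).
Proof.
move=> mv mO; apply: (measurability _ (RGenInftyO.measurableE R)) => //.
move=> _ [_ [c ->] <-].
pose h (q : 'rV[rat]_n) x := phi x (map_mx ratr q) +
   alpha * \sum_i `|v x 0 i - ratr (q 0 i)|.
have mh (q : 'rV[rat]_n) : measurable_fun Omega (h q).
  apply: measurable_funD; first exact: measurable_integrand_cst.
  apply: measurable_funM => //; apply: measurable_sum => i.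
  by apply: measurableT_comp => //; exact: measurable_funB.
have -> : Omega `&` (fun x => phi x (v x)) @^-1` `]-oo, c[ =
    \bigcup_(q in [set: 'rV[rat]_n]) (Omega `&` h q @^-1` `]-oo, c[).
  apply/seteqP; split => [x [Ox]|x [q _ [Ox]]]; rewrite /= !in_itv/=; last first.
    move=> hc; split => //; apply: le_lt_trans hc; rewrite /h.
    have := is_norm_lip (v x) (map_mx ratr q) (phi_norm Ox) (fun xi => phi_alpha xi Ox).
    move=> /le_trans; apply.
    rewrite lerD2l ler_pM2l// le_eqVlt; apply/orP; left; apply/eqP.
    by apply: eq_bigr => i _; rewrite mxE.
  (* The factor 2 pays for the distance from [v x] to [q] twice: once inside [h q], once in
     comparing [phi x q] with [phi x (v x)]. *)
  move=> pc; have e0 : 0 < (c - phi x (v x)) / (2 * alpha).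
    by rewrite divr_gt0 ?subr_gt0 ?mulr_gt0.
  have [q] := rV_ratr_approx_l1 (v x) e0.
  rewrite ltr_pdivlMr ?mulr_gt0// => vq.
  exists q => //; split => //; rewrite /= in_itv/= /h.
  have := is_norm_lip (map_mx ratr q) (v x) (phi_norm Ox) (fun xi => phi_alpha xi Ox).
  have -> : \sum_i `|(map_mx ratr q) 0 i - v x 0 i| =
            \sum_i `|v x 0 i - ratr (q 0 i)|.
    by apply: eq_bigr => i _; rewrite mxE distrC.
  rewrite (_ : _ * (2 * alpha) = 2 * (alpha * \sum_i `|v x 0 i - ratr (q 0 i)|)) in vq.
    lra.
  by ring.
apply: countable_bigcupT_measurable; first exact: countableP.
by move=> q; exact: mh.
Qed.

End integrand.

End euclidean_measurable.

(** * Square-integrable functions and H^1_0 *)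

Section Rintegral_lin.
Context d (T : measurableType d) (R : realType).
Variables (mu : {measure set T -> \bar R}) (D : set T).
Hypothesis mD : measurable D.
Local Notation L1 w := (mu.-integrable D (EFin \o w)).

Lemma EFin_Rintegral f : L1 f ->
  (\int[mu]_(x in D) (f x)%:E)%E = (\int[mu]_(x in D) f x)%:E.
Proof. by move=> fi; rewrite /Rintegral fineK//; exact: integrable_fin_num fi. Qed.

Lemma Rintegral_lin (a : R) (f g : T -> R) : L1 f -> L1 g ->
  \int[mu]_(x in D) (a * f x + g x) =
  a * \int[mu]_(x in D) f x + \int[mu]_(x in D) g x.
Proof.
move=> fi gi; rewrite RintegralD//; last exact: (@integrableZl _ _ _ _ _ mD _ _ fi).
by rewrite RintegralZl.
Qed.

Lemma L1_sum n (f : 'I_n -> T -> R) : (forall i, L1 (f i)) ->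
  L1 (fun x => \sum_(i < n) f i x).
Proof.
move=> fi; rewrite (_ : _ \o _ = (fun x => \sum_(i < n) (f i x)%:E)%E); last first.
  by apply/funext => x /=; rewrite sumEFin.
by apply: integrable_sum => // i _; exact: fi.
Qed.

End Rintegral_lin.

Section L2.
Context {R : realType} {n : nat}.
Variable Omega : set 'rV[R]_n.
Hypothesis mO : measurable Omega.
Local Notation mu := (lebesgue_rV n).
Local Notation L1 w := (mu.-integrable Omega (EFin \o w)).
Implicit Types (u v f g : 'rV[R]_n -> R).

Let le12 : (1 <= 2%:E :> \bar R)%E.
Proof. by rewrite lee_fin ler1n. Qed.

Lemma restrict_lin (a : R) u v :
  (fun x => a * u x + v x) \_ Omega = a *: (u \_ Omega) + v \_ Omega.
Proof.
apply/funext => x; rewrite /GRing.add/= /GRing.scale/= !patchE.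
by case: ifP => // _; rewrite scaler0 addr0.
Qed.

Lemma L2_lin (a : R) u v : L2 Omega u -> L2 Omega v ->
  L2 Omega (fun x => a * u x + v x).
Proof.
move=> Lu Lv; rewrite /L2 restrict_lin.
by have [_ /(_ a _ _ Lu Lv)] := Lfun_submod_closed mu le12.
Qed.

Lemma L2_measurable u : L2 Omega u -> measurable_fun Omega u.
Proof.
rewrite /L2 inE => /andP[/set_mem mu' _].
have [_ h] := measurable_restrictT u mO. exact: h.
Qed.

Lemma L2_mul u v : L2 Omega u -> L2 Omega v -> L1 (fun x => u x * v x).
Proof.
move=> Lu Lv; have /Lfun1_integrable := Lfun2_mul_Lfun1 Lu Lv.
move=> uvi; apply/(integrable_mkcond _ mO); apply: eq_integrable uvi => // x _ /=.
by rewrite !patchE; case: ifP => //; rewrite mul0r.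
Qed.

Hypothesis muO : (mu Omega < +oo)%E.

Lemma L2_bounded f (C : R) : measurable_fun Omega f ->
  (forall x, Omega x -> `|f x| <= C) -> L2 Omega f.
Proof.
move=> mf fC; have mfO : measurable_fun setT (f \_ Omega) by apply/(measurable_restrictT f mO).
rewrite /L2 inE; apply/andP; split; apply: mem_set => //=.
rewrite /finite_norm unlock poweR_lty//.
rewrite (_ : (\int[mu]_x _)%E = (\int[mu]_(x in Omega) (f x ^+ 2)%:E)%E); last first.
  rewrite [RHS]integral_mkcond; apply: eq_integral => x _ /=.
  rewrite /= !patchE; case: ifP => _.
    by rewrite powR_mulrn// real_normK ?num_real.
  by rewrite normr0 powR0.
apply: (@integrable_lty _ _ _ mu Omega mO (EFin \o (fun x => f x ^+ 2))).
apply: measurable_bounded_integrable => //; first exact: measurable_funX.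
exists (C ^+ 2); split => [|M CM x Ox /=]; first exact: num_real.
apply: le_trans (ltW CM); rewrite normrX lerXn2r ?nnegrE ?fC//.
exact: le_trans (fC _ Ox).
Qed.

Lemma L2_integrable u : L2 Omega u -> L1 u.
Proof.
move=> Lu; have L1c : L2 Omega (cst 1) by apply: (@L2_bounded _ 1) => // x _; rewrite normr1.
have := L2_mul Lu L1c; congr (_.-integrable _ _).
by apply/funext => x /=; rewrite mulr1.
Qed.

(** Minkowski's inequality, in the form that lets approximating sequences of test functions be
    combined linearly. *)
Lemma L2dist_lin (a : R) f g u v : L2 Omega f -> L2 Omega g ->
  L2 Omega u -> L2 Omega v ->
  (L2dist Omega (fun x => (a * f x + g x)%R) (fun x => (a * u x + v x)%R) <=
   `|a|%:E * L2dist Omega f u + L2dist Omega g v)%E.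
Proof.
move=> Lf Lg Lu Lv.
have LB h k : L2 Omega h -> L2 Omega k -> L2 Omega (h \- k).
  move=> Lh Lk; have := L2_lin (-1) Lk Lh; congr (L2 _ _).
  by apply/funext => x /=; rewrite mulN1r addrC.
have Lfu := LB _ _ Lf Lu; have Lgv := LB _ _ Lg Lv.
rewrite /L2dist.
rewrite (_ : _ \_ Omega = (a *: ((f \- u) \_ Omega)) \+ ((g \- v) \_ Omega)); last first.
  rewrite -[RHS]restrict_lin; congr (_ \_ _); apply/funext => x /=; lra.
have := @LnormZ _ _ _ mu 2%:E le12 (@Lfun_Sub _ _ _ mu 2%:E le12 _ Lfu) a.
move=> /= <-.
have mres h : L2 Omega h -> measurable_fun setT (h \_ Omega).
  by move=> Lh; apply/(measurable_restrictT h mO); exact: L2_measurable.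
apply: minkowski_EFin; last by rewrite ler1n.
  by apply: measurable_funM => //; exact: mres.
exact: mres.
Qed.

End L2.

(** * Linear combinations and boundedness of test functions *)

Section test_functions.
Context {R : realType} {n : nat}.
Implicit Types (Omega : set 'rV[R]_n) (u v psi chi : 'rV[R]_n -> R).

Lemma derive_lin (a : R) u v x w : derivable u x w -> derivable v x w ->
  derivable (fun x => a * u x + v x) x w /\
  'D_w (fun x => a * u x + v x) x = a * 'D_w u x + 'D_w v x.
Proof.
move=> du dv; have da := @derivableZ _ _ _ u a x w du.
split; first exact: derivableD da dv.
by rewrite [LHS](deriveD da dv) deriveZ.
Qed.

Lemma smooth_lin (a : R) u v : smooth u -> smooth v ->
  smooth (fun x => a * u x + v x).
Proof.
move=> su sv s.
have -> : foldr partial (fun x => a * u x + v x) s =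
    (fun x => a * foldr partial u s x + foldr partial v s x).
  elim: s => //= i s ->.
  apply/funext => x; rewrite /partial.
  have [_ /(_ i x) du] := su s; have [_ /(_ i x) dv] := sv s.
  by have [] := derive_lin a du dv.
have [cu du] := su s; have [cv dv] := sv s; split.
  move=> x; have ca : {for x, continuous (fun y => a * foldr partial u s y)}.
    by apply: continuousM; [exact: cst_continuous|exact: cu].
  exact: (continuousD ca (cv x)).
by move=> i x; have [] := derive_lin a (du i x) (dv i x).
Qed.

Lemma smooth0 : smooth (fun _ : 'rV[R]_n => 0 : R).
Proof.
move=> s; have -> : foldr partial (fun=> 0) s = (fun _ : 'rV[R]_n => 0 : R).
  by elim: s => //= i s ->; apply/funext => x; rewrite /partial derive_cst.
by split=> [x|i x]; [exact: cst_continuous|exact: derivable_cst].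
Qed.

Lemma test_function_lin Omega (a : R) psi chi :
  test_function Omega psi -> test_function Omega chi ->
  test_function Omega (fun x => a * psi x + chi x).
Proof.
move=> [s1 c1 O1] [s2 c2 O2].
have sub : closure [set x | a * psi x + chi x != 0] `<=`
    closure [set x | psi x != 0] `|` closure [set x | chi x != 0].
  rewrite -closureU; apply: closure_subset => x /= ne0.
  have [p0|p0] := eqVneq (psi x) 0; last by left.
  by right; apply: contra_neq ne0 => c0; rewrite p0 c0 mulr0 addr0.
split; first exact: smooth_lin.
- apply: subclosed_compact sub; first exact: closed_closure.
  exact: compactU.
- by move=> x /sub[/O1|/O2].
Qed.

Lemma test_function0 Omega : test_function Omega (fun=> 0).
Proof.
have E : [set x : 'rV[R]_n | (0 : R) != 0] = set0.
  by rewrite -subset0 => x /=; rewrite eqxx.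
split; rewrite ?E ?closure0//; first exact: smooth0.
exact: compact0.
Qed.

Lemma continuous_bounded_on Omega (f : 'rV[R]_n -> R) : bounded_set Omega ->
  continuous f -> exists C, forall x, Omega x -> `|f x| <= C.
Proof.
move=> bO cf; have [M [_ /(_ (`|M| + 1))]] := bO.
rewrite (le_lt_trans (ler_norm _)) ?ltrDl// => /(_ isT) OM.
have M0 : 0 < `|M| + 1 by rewrite ltr_wpDl.
(* [Omega] need not be closed; since [f] is continuous on the whole space, a closed ball containing
   [Omega] supplies the compactness. *)
pose B := closed_ball (0 : 'rV[R]_n) (`|M| + 1).
have cB : compact B.
  apply: bounded_closed_compact; last exact: closed_ball_closed.
  exists (`|M| + 1); split; first exact: num_real.
  move=> K MK x; rewrite /B closed_ballE//= /closed_ball_/= sub0r normrN => xM.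
  exact: le_trans xM (ltW MK).
have /compact_bounded[K [_ /(_ (`|K| + 1))]] : compact (f @` B).
  by apply: continuous_compact => //; exact: continuous_subspaceT.
rewrite (le_lt_trans (ler_norm _)) ?ltrDl// => /(_ isT) fK.
exists (`|K| + 1) => x Ox; apply: fK; exists x => //.
rewrite /B closed_ballE//= /closed_ball_/= sub0r normrN.
exact: OM.
Qed.

End test_functions.

(** * Linear structure of H^1_0 and of weak gradients *)

Section H10.
Context {R : realType} {n : nat}.
Variable Omega : set 'rV[R]_n.
Hypotheses (oO : open Omega) (bO : bounded_set Omega).
Local Notation mu := (lebesgue_rV n).
Local Notation L1 w := (mu.-integrable Omega (EFin \o w)).
Implicit Types (u v psi : 'rV[R]_n -> R) (G K : 'rV[R]_n -> 'rV[R]_n).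

Let mO : measurable Omega. Proof. exact: open_measurable_rV. Qed.

Let muO : (mu Omega < +oo)%E. Proof. exact: bounded_lebesgue_rV_lty. Qed.

Lemma continuous_L2 u : continuous u -> L2 Omega u.
Proof.
move=> cu; have [C uC] := continuous_bounded_on bO cu.
apply: L2_bounded uC => //.
by apply: continuous_measurable_rV => // x _; exact: cu.
Qed.

Lemma test_function_L2 psi : test_function Omega psi -> L2 Omega psi.
Proof. by move=> [/(_ [::])[cpsi _] _ _]; exact: continuous_L2. Qed.

Lemma test_function_partial_L2 psi i : test_function Omega psi ->
  L2 Omega (partial i psi).
Proof. by move=> [/(_ [:: i])[cpsi _] _ _]; exact: continuous_L2. Qed.

Lemma L2v_lin (a : R) G K : L2v Omega G -> L2v Omega K ->
  L2v Omega (fun x => a *: G x + K x).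
Proof.
move=> LG LK i; have := L2_lin a (LG i) (LK i); congr (L2 _ _).
by apply/funext => x; rewrite !mxE.
Qed.

Lemma weak_gradient_lin (a : R) u v G K : L2 Omega u -> L2 Omega v ->
  weak_gradient Omega u G -> weak_gradient Omega v K ->
  weak_gradient Omega (fun x => a * u x + v x) (fun x => a *: G x + K x).
Proof.
move=> Lu Lv [LG wG] [LK wK]; split; first exact: L2v_lin.
move=> psi i tpsi; have Lp := test_function_L2 tpsi.
have Ldp := test_function_partial_L2 i tpsi.
have iu := L2_mul mO Lu Ldp; have iv := L2_mul mO Lv Ldp.
have iG := L2_mul mO (LG i) Lp; have iK := L2_mul mO (LK i) Lp.
have uG : \int[mu]_(x in Omega) (u x * partial i psi x) =
    - \int[mu]_(x in Omega) (G x 0 i * psi x).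
  by have := wG _ i tpsi; rewrite !EFin_Rintegral// -EFinN => -[].
have vK : \int[mu]_(x in Omega) (v x * partial i psi x) =
    - \int[mu]_(x in Omega) (K x 0 i * psi x).
  by have := wK _ i tpsi; rewrite !EFin_Rintegral// -EFinN => -[].
transitivity (\int[mu]_(x in Omega)
    (a * (u x * partial i psi x) + v x * partial i psi x)%:E)%E.
  by apply: eq_integral => x _; congr EFin; ring.
transitivity (- \int[mu]_(x in Omega)
    (a * (G x 0 i * psi x) + K x 0 i * psi x)%:E)%E; last first.
  by congr oppe; apply: eq_integral => x _; congr EFin; rewrite !mxE; ring.
rewrite !EFin_Rintegral//; try exact: L1_lin.
by rewrite !Rintegral_lin// uG vK -EFinN; congr EFin; ring.
Qed.

Lemma sobolev_H10_lin (a : R) u v : sobolev_H10 Omega u -> sobolev_H10 Omega v ->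
  sobolev_H10 Omega (fun x => a * u x + v x).
Proof.
move=> [[Lu _] [G wG [psi [tpsi psiu psiG]]]] [[Lv _] [K wK [chi [tchi chiv chiK]]]].
have wGK := weak_gradient_lin a Lu Lv wG wK.
have cvg0 (d1 d2 d3 : nat -> \bar R) :
    (forall k, 0 <= d3 k <= `|a|%:E * d1 k + d2 k)%E ->
    d1 k @[k --> \oo] --> 0%E -> d2 k @[k --> \oo] --> 0%E ->
    d3 k @[k --> \oo] --> 0%E.
  move=> d0 d10 d20.
  apply: (@squeeze_cvge _ _ _ _ (cst 0%E) _ (fun k => `|a|%:E * d1 k + d2 k)%E) => //.
  - exact: nearW.
  - exact: cvg_cst.
  - rewrite -[X in _ --> X]adde0 -[X in _ --> (X + _)%E](mule0 `|a|%:E).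
    by apply: cvgeD => //; exact: cvgeZl.
split; first by split; [exact: L2_lin|exists (fun x => a *: G x + K x)].
exists (fun x => a *: G x + K x) => //.
exists (fun k x => a * psi k x + chi k x); split.
- by move=> k; exact: test_function_lin.
- apply: cvg0 psiu chiv => k; rewrite Lnorm_ge0/=.
  by apply: L2dist_lin => //; exact: test_function_L2.
- move=> i; apply: cvg0 (psiG i) (chiK i) => k; rewrite Lnorm_ge0/=.
  have -> : partial i (fun x => a * psi k x + chi k x) =
      (fun x => a * partial i (psi k) x + partial i (chi k) x).
    have [s1 _ _] := tpsi k; have [s2 _ _] := tchi k.
    apply/funext => x; rewrite /partial.
    have [_ /(_ i x) du] := s1 [::]; have [_ /(_ i x) dv] := s2 [::].
    by have [] := derive_lin a du dv.
  have -> : (fun x => (a *: G x + K x) 0 i) = (fun x => a * G x 0 i + K x 0 i).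
    by apply/funext => x; rewrite !mxE.
  by apply: L2dist_lin; try exact: test_function_partial_L2; [|case: wG|case: wK].
Qed.

Lemma weak_gradient0 : weak_gradient Omega (fun=> 0) (fun=> 0).
Proof.
split=> [i|psi i _].
  rewrite (_ : (fun x => _) = (fun=> 0)); last by apply/funext => x; rewrite mxE.
  by apply: continuous_L2 => x; exact: cst_continuous.
rewrite (_ : (fun x => _) = cst 0%E); last by apply/funext => x; rewrite mul0r.
rewrite [in RHS](_ : (fun x => _) = cst 0%E); last by apply/funext => x; rewrite mxE mul0r.
by rewrite integral0 oppe0.
Qed.

Lemma sobolev_H10_0 : sobolev_H10 Omega (fun=> 0).
Proof.
have wG := weak_gradient0.
split; first by split; [apply: continuous_L2 => x; exact: cst_continuous|exists (fun=> 0)].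
exists (fun=> 0) => //; exists (fun _ _ => 0).
have d0 (f g : 'rV[R]_n -> R) : f =1 g -> L2dist Omega f g = 0%E.
  have p0 : (2%:E != 0 :> \bar R)%E by rewrite eqe pnatr_eq0.
  move=> fg; rewrite /L2dist (_ : EFin \o _ = cst 0%E) ?Lnorm0//.
  by apply/funext => x /=; rewrite patchE; case: ifP => // _; rewrite /= fg subrr.
split.
- by move=> _; exact: test_function0.
- rewrite (_ : (fun k => _) = cst 0%E); first exact: cvg_cst.
  by apply/funext => k; exact: d0.
- move=> i; rewrite (_ : (fun k => _) = cst 0%E); first exact: cvg_cst.
  by apply/funext => k; apply: d0 => x; rewrite /partial derive_cst mxE.
Qed.

End H10.

(** * Duality *)

(** Applied to the integrand of the duality gap: the sign gives weak duality, the vanishing case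
    gives the pointwise identity for minimizers. *)
Lemma ae_ge0_Rintegral d (T : measurableType d) (R : realType)
    (mu : {measure set T -> \bar R}) (D : set T) (h : T -> R) :
  measurable D -> mu.-integrable D (EFin \o h) ->
  {ae mu, forall x, D x -> 0 <= h x} ->
  0 <= \int[mu]_(x in D) h x /\
  (\int[mu]_(x in D) h x = 0 -> {ae mu, forall x, D x -> h x = 0}).
Proof.
move=> mD ih h0; have mh := measurable_int mu ih.
have E : (\int[mu]_(x in D) (h x)%:E = \int[mu]_(x in D) `|(h x)%:E|)%E.
  apply: ae_eq_integral => //; first exact: measurableT_comp mh.
  by apply: filterS h0 => x h0 Dx /=; rewrite ger0_norm ?h0.
split; first by rewrite /Rintegral E fine_ge0// integral_ge0.
move=> h00; have : (\int[mu]_(x in D) `|(h x)%:E|)%E = 0%E.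
  by rewrite -E EFin_Rintegral// h00.
move=> /(ae_eq_integral_abs mu mD mh); apply: filterS => x hx Dx.
by have [] := hx Dx.
Qed.

Section zero_gap.
Context {R : realType} {n : nat}.
Variables (Omega : set 'rV[R]_n) (F : 'rV[R]_n -> 'rV[R]_n) (H : 'rV[R]_n -> R).
Variables (phi : 'rV[R]_n -> 'rV[R]_n -> R) (alpha m : R).
Local Notation mu := (lebesgue_rV n).
Local Notation L1 w := (mu.-integrable Omega (EFin \o w)).
Local Notation vfield := ('rV[R]_n -> 'rV[R]_n).
Hypotheses (oO : open Omega) (bO : bounded_set Omega).
Hypotheses (F_L2 : L2v Omega F) (H_L2 : L2 Omega H).
Hypothesis phi_cont : {within Omega `*` setT, continuous
                 (fun z : 'rV[R]_n * 'rV[R]_n => phi z.1 z.2)}.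
Hypothesis alpha0 : 0 < alpha.
Hypothesis phi_alpha : forall x xi, Omega x -> phi x xi <= alpha * enorm xi.
Hypothesis phi_norm : forall x, Omega x -> is_norm (phi x).
Hypothesis primal_ge : lbound (primal_values Omega phi F H) m%:E.

Let mO : measurable Omega. Proof. exact: open_measurable_rV. Qed.

Let muO : (mu Omega < +oo)%E. Proof. exact: bounded_lebesgue_rV_lty. Qed.

Definition L1v (v : vfield) := forall i, L1 (fun x => v x 0 i).

(** A weak gradient is determined only up to a null set, so the variable of the problem is the pair;
    these pairs are closed under linear combinations. *)
Definition admissible u (G : vfield) := sobolev_H10 Omega u /\ weak_gradient Omega u G.

Let p (v : vfield) : R := \int[mu]_(x in Omega) phi x (v x).

Let l (u : 'rV[R]_n -> R) : R := \int[mu]_(x in Omega) (H x * u x).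

Let L2v_L1v v : L2v Omega v -> L1v v.
Proof. by move=> Lv i; apply: L2_integrable. Qed.

Lemma L1v_lin (a : R) (v w : vfield) : L1v v -> L1v w -> L1v (a *: v + w).
Proof.
move=> Sv Sw i; have := L1_lin mO a (Sv i) (Sw i).
congr (_.-integrable _ _); apply/funext => x.
by rewrite [in RHS]/= !mxE.
Qed.

Let L1vD v w : L1v v -> L1v w -> L1v (v + w).
Proof. by move=> Sv Sw; rewrite -[v]scale1r; exact: L1v_lin. Qed.

Lemma L1v0 : L1v 0.
Proof.
move=> i; rewrite (_ : _ \o _ = cst 0%E); first exact: integrable0.
by apply/funext => x /=; rewrite mxE.
Qed.

Let L1vZ a v : L1v v -> L1v (a *: v).
Proof. by move=> Sv; rewrite -[_ *: _]addr0; apply: L1v_lin => //; exact: L1v0. Qed.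

Let L1_phi v : L1v v -> L1 (fun x => phi x (v x)).
Proof.
move=> Sv; apply: (@le_integrable _ _ _ _ _ mO _
  (fun x => alpha%:E * (\sum_i `|v x 0 i|)%:E)%E).
- apply/measurable_EFinP; apply: (measurable_integrand oO phi_cont alpha0) => //.
  by move=> i; apply/measurable_EFinP; exact: measurable_int (Sv i).
- move=> x Ox; rewrite -EFinM /= lee_fin.
  have [f0 _ _ _] := phi_norm Ox; rewrite ger0_norm ?f0//.
  apply: le_trans (is_norm_le_l1 _ (phi_norm Ox) (fun xi => phi_alpha xi Ox)) _.
  exact: ler_norm.
- apply: integrableZl => //.
  apply: (@L1_sum _ _ _ _ _ mO _ (fun i x => `|v x 0 i|)) => i.
  exact: integrable_norm.
Qed.

Let L1_l u : L2 Omega u -> L1 (fun x => H x * u x).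
Proof. by move=> Lu; exact: L2_mul. Qed.

Let pD v w : L1v v -> L1v w -> p (v + w) <= p v + p w.
Proof.
move=> Sv Sw; rewrite -RintegralD//; try exact: L1_phi.
apply: le_Rintegral => //; first by apply: L1_phi; exact: L1vD.
  exact: (integrableD mO (L1_phi Sv) (L1_phi Sw)).
by move=> x Ox; have [_ _ _] := phi_norm Ox; apply.
Qed.

Let pZ a v : L1v v -> p (a *: v) = `|a| * p v.
Proof.
move=> Sv; rewrite -RintegralZl//; last exact: L1_phi.
apply: eq_Rintegral => x /set_mem Ox.
by have [_ _ + _] := phi_norm Ox; apply.
Qed.

Let p0 : p 0 = 0.
Proof. by rewrite -(scale0r 0) pZ ?normr0 ?mul0r//; exact: L1v0. Qed.

Let adm_lin (a : R) u v G K : admissible u G -> admissible v K ->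
  admissible (fun x => a * u x + v x) (a *: G + K).
Proof.
move=> [Hu wG] [Hv wK]; split; first exact: sobolev_H10_lin.
by apply: weak_gradient_lin => //; [case: Hu => -[]|case: Hv => -[]].
Qed.

Let adm0 : admissible (fun=> 0) 0.
Proof. by split; [exact: sobolev_H10_0|exact: weak_gradient0]. Qed.

Let admZ (a : R) u G : admissible u G -> admissible (fun x => a * u x) (a *: G).
Proof.
move=> /(adm_lin a)/(_ adm0); rewrite addr0; congr (admissible _ _).
by apply/funext => x; rewrite addr0.
Qed.

Let adm_L2 u G : admissible u G -> L2 Omega u.
Proof. by move=> [[[]]]. Qed.

Let adm_L1v u G : admissible u G -> L1v G.
Proof. by move=> [_ []] /L2v_L1v. Qed.

Let l_lin (a : R) u v : L2 Omega u -> L2 Omega v ->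
  l (fun x => a * u x + v x) = a * l u + l v.
Proof.
move=> Lu Lv; rewrite -Rintegral_lin//; try exact: L1_l.
by apply: eq_Rintegral => x _; ring.
Qed.

Let lZ (a : R) u : L2 Omega u -> l (fun x => a * u x) = a * l u.
Proof.
by move=> Lu; rewrite -RintegralZl//; [apply: eq_Rintegral => x _; ring|exact: L1_l].
Qed.

Let l0 : l (fun=> 0) = 0.
Proof.
rewrite -[RHS](mul0r (l (fun=> 0))) -(lZ 0 (adm_L2 adm0)); congr l.
by apply/funext => x; rewrite mul0r.
Qed.

Let FS : L1v F. Proof. exact: L2v_L1v. Qed.

Lemma primal_energyE u G : admissible u G ->
  primal_energy Omega phi F H u G = (p (F + G) + l u)%:E.
Proof.
move=> uG; have SG := adm_L1v uG; have Lu := adm_L2 uG.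
have SFG := L1vD FS SG.
rewrite -RintegralD//; [|exact: L1_phi|exact: L1_l].
rewrite /primal_energy -EFin_Rintegral//; last first.
  exact: (integrableD mO (L1_phi SFG) (L1_l Lu)).
by apply: eq_integral => x _; rewrite (addrC (G x)).
Qed.

Let primal_le u G : admissible u G -> m <= p (F + G) + l u.
Proof.
move=> uG; rewrite -lee_fin -primal_energyE//; apply: primal_ge.
by exists u, G; case: uG => ? ?; split.
Qed.

(* Scaling [(u, G)] by a large factor in the lower bound [m] kills [m] and [F]. *)
Let pl_ge0 u G : admissible u G -> 0 <= p G + l u.
Proof.
move=> uG; have SG := adm_L1v uG; have Lu := adm_L2 uG.
rewrite leNgt; apply/negP => c0; set c := p G + l u in c0.
have pl t : 0 <= t -> m <= p F + t * c.
  move=> t0; have := primal_le (admZ t uG); rewrite lZ//.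
  have := pD FS (L1vZ t SG); rewrite pZ// ger0_norm// /c; lra.
have t0 : 0 <= (`|m| + `|p F| + 1) / - c by rewrite divr_ge0 ?oppr_ge0 ?addr_ge0// ltW.
have := pl _ t0; rewrite invrN mulrN mulNr -mulrA mulVf ?lt_eqF// mulr1.
by have := ler_norm (p F); have := ler_norm (- m); rewrite normrN; lra.
Qed.

(** * The value function of the primal problem *)

Let qset v := [set p (v + uG.2) + l uG.1 |
  uG in [set uG : ('rV[R]_n -> R) * vfield | admissible uG.1 uG.2]].

Let q v := inf (qset v).

(** The triangle inequality gives [p G <= p (v + G) + p v], and [pl_ge0] bounds [p G + l u] from
    below by 0. *)
Let qset_ge v : L1v v -> lbound (qset v) (- p v).
Proof.
move=> Sv _ [[u G] /= uG <-]; have SG := adm_L1v uG.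
have := pl_ge0 uG; have := pD (L1vD Sv SG) (L1vZ (-1) Sv).
rewrite pZ// normrN1 mul1r scaleN1r [v + G]addrC addrK; lra.
Qed.

Let qset0 v : qset v !=set0.
Proof. by exists (p (v + 0) + l (fun=> 0)), (fun=> 0, 0) => //; exact: adm0. Qed.

Let q_le v u G : L1v v -> admissible u G -> q v <= p (v + G) + l u.
Proof.
move=> Sv uG; apply: ge_inf; first by exists (- p v); exact: qset_ge.
by exists (u, G).
Qed.

Let q_ge v c : (forall u G, admissible u G -> c <= p (v + G) + l u) -> c <= q v.
Proof.
move=> cv; apply: lb_le_inf => // _ [[u G] /= uG <-]; exact: cv.
Qed.

Let q_le_p v : L1v v -> q v <= p v.
Proof. by move=> Sv; have := q_le Sv adm0; rewrite l0 !addr0. Qed.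

Let qD v w : L1v v -> L1v w -> q (v + w) <= q v + q w.
Proof.
move=> Sv Sw; rewrite -lerBlDr; apply: q_ge => u G uG.
rewrite lerBlDr -lerBlDl; apply: q_ge => u' G' uG'.
have SG := adm_L1v uG; have SG' := adm_L1v uG'.
have := q_le (L1vD Sv Sw) (adm_lin 1 uG uG').
rewrite l_lin ?(adm_L2 uG) ?(adm_L2 uG')// mul1r scale1r addrACA.
have := pD (L1vD Sv SG) (L1vD Sw SG'); lra.
Qed.

(** Rescaling the competitor gives one inequality, and the same inequality for [a^-1] gives the
    other. The case [a = 0] says [q 0 = 0], which is [pl_ge0]. *)
Let qZ a v : 0 <= a -> L1v v -> q (a *: v) = a * q v.
Proof.
rewrite le_eqVlt => /predU1P[<-|a0] Sv.
  rewrite scale0r mul0r; apply/eqP; rewrite eq_le.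
  have := q_le_p L1v0; rewrite p0 => -> /=.
  by apply: q_ge => u G uG; rewrite add0r; exact: pl_ge0.
have qZle b w : 0 < b -> L1v w -> q (b *: w) <= b * q w.
  move=> b0 Sw; rewrite -ler_pdivrMl//; apply: q_ge => u G uG.
  rewrite ler_pdivrMl//; have := q_le (L1vZ b Sw) (admZ b uG).
  rewrite -scalerDr pZ ?(gtr0_norm b0) ?lZ ?(adm_L2 uG)//; first lra.
  by apply: L1vD => //; exact: adm_L1v uG.
apply/eqP; rewrite eq_le qZle//=.
have ai : 0 < a^-1 by rewrite invr_gt0.
have := qZle _ _ ai (L1vZ a Sv).
by rewrite scalerA mulVf ?gt_eqF// scale1r ler_pdivlMl.
Qed.

Lemma exists_functional : exists f : vfield -> R,
  [/\ forall a v w, L1v v -> L1v w -> f (a *: v + w) = a * f v + f w,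
      forall v, L1v v -> f v <= p v,
      primal_inf Omega phi F H = (f F)%:E &
      forall u G, admissible u G -> f G = - l u].
Proof.
have [f [f_lin fq fF]] := hahn_banach L1v0 L1v_lin qD qZ FS.
exists f; split => //.
- by move=> v Sv; apply: le_trans (fq _ Sv) (q_le_p Sv).
- rewrite fF /primal_inf /q -ereal_inf_EFin; [|by exists (- p F); exact: qset_ge|exact: qset0].
  congr ereal_inf; apply/seteqP; split => [_ [u [G [Hu wG ->]]]|_ [_ [[u G] /= uG <-] <-]].
    by exists (p (F + G) + l u); [exists (u, G)|rewrite primal_energyE].
  by exists u, G; case: (uG) => ? ?; split => //; rewrite primal_energyE.
- move=> u G uG.
  have f0 : f 0 = 0 by have := f_lin 1 _ _ L1v0 L1v0; rewrite scaler0 addr0; lra.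
  have fN K : L1v K -> f (-1 *: K) = - f K.
    by move=> SK; have := f_lin (-1) _ _ SK L1v0; rewrite addr0 f0; lra.
  (* At the datum [- K] the competitor [(v, K)] cancels the argument of [p], leaving
     [q (-1 *: K) <= l v]. *)
  have le_l v K : admissible v K -> - f K <= l v.
    move=> vK; have SK := adm_L1v vK; rewrite -fN//.
    apply: le_trans (fq _ (L1vZ _ SK)) _; have := q_le (L1vZ (-1) SK) vK.
    by rewrite scaleN1r addNr p0 add0r.
  have := le_l _ _ uG; have := le_l _ _ (admZ (-1) uG).
  by rewrite lZ ?(adm_L2 uG)// fN; [lra|exact: adm_L1v uG].
Qed.

(** * The vector field representing the functional *)

Section density.
Variable f : vfield -> R.
Hypothesis f_lin : forall a v w, L1v v -> L1v w -> f (a *: v + w) = a * f v + f w.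
Hypothesis f_le : forall v, L1v v -> f v <= p v.

Let f0 : f 0 = 0.
Proof. have := f_lin 1 L1v0 L1v0; rewrite scaler0 addr0; lra. Qed.

Let f_sum k (w : 'I_k -> vfield) : (forall i, L1v (w i)) ->
  L1v (\sum_(i < k) w i) /\ f (\sum_(i < k) w i) = \sum_(i < k) f (w i).
Proof.
elim: k w => [|k IH] w Sw; first by rewrite !big_ord0; split; [exact: L1v0|exact: f0].
rewrite !big_ord_recl/=.
have [Sr fr] := IH (fun i => w (lift ord0 i)) (fun i => Sw _).
split; first exact: L1vD.
by rewrite -fr -[f (w ord0)]mul1r -f_lin// scale1r.
Qed.

Let L1v_delta i w : L1 w -> L1v (fun x => w x *: delta_mx 0 i).
Proof.
move=> iw j; have := L1_lin mO (j == i)%:R iw (L1v0 j).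
congr (_.-integrable _ _); apply/funext => x /=; congr EFin.
by rewrite !mxE eqxx/= addr0 mulrC.
Qed.

(** The scalar representation is applied to each [w |-> f (w e_i)]. Its bound is [alpha] because the
    basis vector [e_i] has Euclidean norm 1. *)
Lemma functional_density : exists N : vfield,
  [/\ forall i, measurable_fun setT (fun x => N x 0 i),
      forall x i, `|N x 0 i| <= alpha &
      forall v, L1v v -> L1 (fun x => dotv (N x) (v x)) /\
        f v = \int[mu]_(x in Omega) dotv (N x) (v x)].
Proof.
have N_ i : exists N : 'rV[R]_n -> R,
    [/\ measurable_fun [set: 'rV[R]_n] N, forall x, `|N x| <= alpha &
      forall w, L1 w -> f (fun x => w x *: delta_mx 0 i) =
                        \int[mu]_(x in Omega) (N x * w x)].
  apply: (L1_riesz mO muO (ltW alpha0) (g := fun w => f (fun x => w x *: delta_mx 0 i))).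
    move=> a v w iv iw; rewrite -f_lin; try exact: L1v_delta.
    by congr f; apply/funext => x; rewrite scalerDl -scalerA.
  move=> w iw; apply: le_trans (f_le (L1v_delta i iw)) _.
  rewrite -RintegralZl//; last exact: integrable_norm.
  apply: le_Rintegral => //; first by apply: L1_phi; exact: L1v_delta.
    exact: (@integrableZl _ _ _ mu _ mO alpha _ (integrable_norm iw)).
  move=> x Ox; have [_ _ fZ _] := phi_norm Ox.
  rewrite fZ mulrC ler_wpM2r//; apply: le_trans (phi_alpha _ Ox) _.
  by rewrite enorm_delta mulr1.
pose N x := \row_i sval (cid (N_ i)) x.
have NE x i : N x 0 i = sval (cid (N_ i)) x by rewrite mxE.
exists N; split.
- move=> i; rewrite (_ : (fun x => _) = sval (cid (N_ i))); last first.
    by apply/funext => x; rewrite NE.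
  by case: cid => ? [].
- by move=> x i; rewrite NE; case: cid => ? [].
move=> v Sv; have iNv i : L1 (fun x => N x 0 i * v x 0 i).
  rewrite (_ : (fun x => _) = (fun x => sval (cid (N_ i)) x * v x 0 i)); last first.
    by apply/funext => x; rewrite NE.
  case: cid => Ni [mN NC _] /=; apply: (L1_bounded_mul mO _ NC) => //.
  exact: measurable_funTS.
split; first exact: (L1_sum mO iNv).
have vE : v = \sum_(i < n) (fun x => v x 0 i *: delta_mx 0 i).
  apply/funext => x; rewrite {1}(row_sum_delta (v x)).
  by rewrite fct_sumE.
have [_] := f_sum (fun i => L1v_delta i (Sv i)); rewrite -vE => ->.
have Rlin a (g h : 'rV[R]_n -> R) : L1 g -> L1 h ->
    \int[mu]_(x in Omega) (a * g x + h x) =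
    a * \int[mu]_(x in Omega) g x + \int[mu]_(x in Omega) h x.
  exact: Rintegral_lin.
(* Here the linear functional is the integral itself, with all coefficients equal to 1. *)
have [_] := functional_sum mO Rlin (fun=> 1) iNv.
rewrite (_ : (fun x => \sum_(i < n) 1 * (N x 0 i * v x 0 i)) =
             (fun x => dotv (N x) (v x))); last first.
  by apply/funext => x; apply: eq_bigr => i _; rewrite mul1r.
move=> ->; apply: eq_bigr => i _; rewrite mul1r.
have [_ _ ->//] := svalP (cid (N_ i)).
by apply: eq_Rintegral => x _; rewrite NE.
Qed.

(** Testing with [\1_E x *: y] for every measurable [E] gives the inequality a.e. for a fixed [y].
    The exceptional null set depends on [y], so only countably many [y] can be treated at once. *)
Lemma density_le (N : vfield) : (forall x i, `|N x 0 i| <= alpha) ->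
  (forall v, L1v v -> L1 (fun x => dotv (N x) (v x)) /\
     f v = \int[mu]_(x in Omega) dotv (N x) (v x)) ->
  {ae mu, forall x, Omega x -> forall xi, dotv (N x) xi <= phi x xi}.
Proof.
move=> NC fN.
have L1cst (y : 'rV[R]_n) : L1v (fun=> y).
  by move=> i; apply: L2_integrable => //; apply: continuous_L2 => // x; exact: cst_continuous.
have ae_q (y : 'rV[R]_n) : {ae mu, forall x, Omega x -> dotv (N x) y <= phi x y}.
  apply: ae_le_of_integral_le => //; [exact: (fN _ (L1cst y)).1|exact: (L1_phi (L1cst y))|].
  move=> E EO mE.
  have Sv : L1v (fun x => \1_E x *: y).
    move=> i; have := L1_lin mO (y 0 i) (L1_indic mO muO mE) (L1v0 i).
    congr (_.-integrable _ _); apply/funext => x /=; congr EFin.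
    by rewrite !mxE addr0 mulrC.
  (* Off [E] the test field is 0, so localization needs integrands that vanish at 0. *)
  have intE (h : 'rV[R]_n -> 'rV[R]_n -> R) : (forall x, Omega x -> h x 0 = 0) ->
      \int[mu]_(x in Omega) h x (\1_E x *: y) = \int[mu]_(x in E) h x y.
    move=> h0; rewrite -[in RHS](setIidr EO) Rintegral_mkcondr.
    apply: eq_Rintegral => x /set_mem Ox; rewrite patchE indicE.
    by case: ifP => _; rewrite ?scale1r// scale0r h0.
  have := f_le Sv; rewrite (fN _ Sv).2 /p.
  rewrite (intE (fun x => dotv (N x))); last first.
    by move=> x _; rewrite /dotv big1// => i _; rewrite mxE mulr0.
  rewrite (intE phi)// => x Ox.
  by have [_ _ fZ _] := phi_norm Ox; rewrite -(scale0r 0) fZ normr0 mul0r.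
(* Rational vectors are enumerated by their codes; a code of no vector imposes the trivial condition
   [true]. *)
have : {ae mu, forall x, forall k : nat, Omega x ->
    if @choice.unpickle 'rV[rat]_n k is Some r then
      dotv (N x) (map_mx ratr (r : 'rV[rat]_n)) <= phi x (map_mx ratr r) else true}.
  apply: ae_foralln => k; case: (choice.unpickle k) => [r|]; first exact: ae_q.
  by apply: aeW.
apply: filterS => x Nx Ox; apply: (dotv_le_norm_of_rat alpha0 (phi_norm Ox)) => //.
  by move=> xi; exact: phi_alpha.
by move=> r; have := Nx (choice.pickle r) Ox; rewrite choice.pickleK.
Qed.

End density.

(** Normalizing [xi] to [phi x xi = 1] uses homogeneity; if [phi x xi = 0], definiteness gives
    [xi = 0]. *)
Lemma dual_norm_le1 x b : Omega x ->
  (dual_norm phi x b <= 1)%E <-> forall xi, dotv b xi <= phi x xi.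
Proof.
move=> Ox; have [ph0 phe phZ _] := phi_norm Ox; split => [b1 xi|bp]; last first.
  by apply: ub_ereal_sup => _ [xi /= xi1 <-]; rewrite lee_fin (le_trans (bp _)).
have [xi0|xin0] := eqVneq (phi x xi) 0.
  rewrite xi0 (phe _ xi0) /dotv big1// => i _; by rewrite mxE mulr0.
have xi0 : 0 < phi x xi by rewrite lt_neqAle eq_sym xin0 ph0.
have : ((dotv b ((phi x xi)^-1 *: xi))%:E <= 1)%E.
  apply: le_trans b1; apply: ereal_sup_ubound; exists ((phi x xi)^-1 *: xi) => //=.
  by rewrite phZ ger0_norm ?invr_ge0 ?ph0// mulVf.
by rewrite lee_fin dotvZr ler_pdivrMl// mulr1.
Qed.

(** Membership in [D0_tilde] replaces the integral of [dotv (G x) (b x)] by [- l u], so the gap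
    between the two values becomes the integral of [h]; the dual norm bound makes [h]
    nonnegative. *)
Lemma weak_duality b u G : dual_feasible Omega phi H b -> admissible u G ->
  let h x := phi x ((F + G) x) - dotv (b x) ((F + G) x) in
  [/\ L1 h, {ae mu, forall x, Omega x -> 0 <= h x} &
      \int[mu]_(x in Omega) h x =
        p (F + G) + l u - \int[mu]_(x in Omega) dotv (F x) (b x)].
Proof.
move=> [[Lb bD] b1] uG h.
have SFG := L1vD FS (adm_L1v uG).
have [_ [LG _]] := uG.
have idot v : L2v Omega v -> L1 (fun x => dotv (v x) (b x)).
  by move=> Lv; apply: (L1_sum mO (f := fun i x => v x 0 i * b x 0 i)) => i; exact: L2_mul.
have iF := idot _ F_L2; have iG := idot _ LG; have iu := L1_l (adm_L2 uG).
have iFG : L1 (fun x => dotv (b x) ((F + G) x)).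
  have := L1_lin mO 1 iF iG; congr (_.-integrable _ _); apply/funext => x /=.
  by rewrite mul1r dotvDr dotvC [dotv (G x) _]dotvC.
have EFG : \int[mu]_(x in Omega) dotv (b x) ((F + G) x) =
    \int[mu]_(x in Omega) dotv (F x) (b x) + \int[mu]_(x in Omega) dotv (G x) (b x).
  rewrite -RintegralD//; apply: eq_Rintegral => x _.
  by rewrite dotvDr dotvC [dotv (G x) _]dotvC.
have : \int[mu]_(x in Omega) dotv (G x) (b x) + l u = 0.
  apply: EFin_inj; rewrite -RintegralD// -EFin_Rintegral//.
    by apply: bD; case: uG.
  exact: (integrableD mO iG iu).
split.
- exact: (integrableB mO (L1_phi SFG) iFG).
- by apply: filterS b1 => x bx Ox; rewrite subr_ge0; exact: ((dual_norm_le1 _ Ox).1 (bx Ox)).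
- by rewrite RintegralB//; [rewrite EFG -/(p _); lra|exact: L1_phi].
Qed.

Lemma dual_attainment : exists N : vfield,
  [/\ dual_feasible Omega phi H N,
      dual_value Omega F N = dual_sup Omega phi F H,
      primal_inf Omega phi F H = dual_value Omega F N &
      forall u G, primal_minimizer Omega phi F H u G ->
        {ae mu, forall x, Omega x -> G x + F x != 0 ->
           let nu := (enorm (G x + F x))^-1 *: (G x + F x) in
           phi x nu = dotv (N x) nu}].
Proof.
have [f [f_lin f_le fF fG]] := exists_functional.
have [N [mN NC fN]] := functional_density f_lin f_le.
have Ndot := density_le f_le NC fN.
have LN : L2v Omega N.
  by move=> i; apply: (L2_bounded mO muO (C := alpha)) => //; exact: measurable_funTS.
have Nfeas : dual_feasible Omega phi H N.
  split; last by apply: filterS Ndot => x Nx Ox; exact: ((dual_norm_le1 _ Ox).2 (Nx Ox)).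
  split => // u G Hu wG; have uG : admissible u G by [].
  have [iNG fGE] := fN _ (adm_L1v uG).
  have iGN : L1 (fun x => dotv (G x) (N x)).
    by move: iNG; congr (_.-integrable _ _); apply/funext => x /=; rewrite dotvC.
  have iu := L1_l (adm_L2 uG).
  rewrite EFin_Rintegral//; last exact: (integrableD mO iGN iu).
  rewrite RintegralD//; congr EFin.
  rewrite (@eq_Rintegral _ _ _ _ _ (fun x => dotv (N x) (G x))); last first.
    by move=> x _; exact: dotvC.
  by rewrite -fGE (fG _ _ uG) -/(l u) addNr.
have L1dual b : dual_feasible Omega phi H b -> L1 (fun x => dotv (F x) (b x)).
  move=> [[Lb _] _].
  by apply: (L1_sum mO (f := fun i x => F x 0 i * b x 0 i)) => i; exact: L2_mul.
have dualE b : dual_feasible Omega phi H b ->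
    dual_value Omega F b = (\int[mu]_(x in Omega) dotv (F x) (b x))%:E.
  by move=> bf; rewrite -EFin_Rintegral//; exact: L1dual.
have FN : \int[mu]_(x in Omega) dotv (F x) (N x) = f F.
  by rewrite (fN _ FS).2; apply: eq_Rintegral => x _; exact: dotvC.
have PD : primal_inf Omega phi F H = dual_value Omega F N by rewrite fF dualE// FN.
exists N; split => //.
  apply/eqP; rewrite eq_le; apply/andP; split.
    by apply: ereal_sup_ubound; exists N.
  (* The value of [N] is the primal infimum, so optimality of [N] is weak duality for [b] against
     every admissible pair. *)
  apply: ub_ereal_sup => _ [b bf <-]; rewrite -PD.
  apply: le_ereal_inf_tmp => _ [u [G [Hu wG ->]]]; have uG : admissible u G by [].
  have [ih h0 hE] := weak_duality bf uG.
  rewrite primal_energyE// dualE// lee_fin -subr_ge0 -hE.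
  by have [] := ae_ge0_Rintegral mO ih h0.
move=> u G [Hu wG]; have uG : admissible u G by [].
rewrite PD primal_energyE// dualE// => -[gap0].
have [ih h0 hE] := weak_duality Nfeas uG.
have [_ /(_ _)] := ae_ge0_Rintegral mO ih h0.
rewrite hE gap0 subrr => /(_ erefl); apply: filterS => x hx Ox _ /=.
have [_ _ phZ _] := phi_norm Ox.
(* Both sides are positively homogeneous, so the normalizing factor comes out and the identity is
   the vanishing of the gap integrand at [x]. *)
rewrite phZ dotvZr ger0_norm ?invr_ge0 ?sqrtr_ge0//; congr (_ * _).
by rewrite [G x + _]addrC; apply/eqP; rewrite -subr_eq0; apply/eqP; exact: hx.
Qed.

End zero_gap.

Theorem theorem3p1 (R : realType) (n : nat) (n_gt0 : (0 < n)%N)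
  (Omega : set 'rV[R]_n) (dom_Omega : domain Omega)
  (bnd_Omega : bounded_set Omega) (lip_Omega : lipschitz_boundary Omega)
  (F : 'rV[R]_n -> 'rV[R]_n) (F_L2 : L2v Omega F)
  (H : 'rV[R]_n -> R) (H_L2 : L2 Omega H)
  (phi : 'rV[R]_n -> 'rV[R]_n -> R)
  (phi_cont : {within Omega `*` setT, continuous
                 (fun z : 'rV[R]_n * 'rV[R]_n => phi z.1 z.2)})
  (phi_convex : forall x, Omega x -> @convex_function R 'rV[R]_n setT (phi x))
  (phi_growth : exists2 alpha : R, 0 < alpha &
     forall x xi, Omega x -> 0 <= phi x xi <= alpha * enorm xi)
  (phi_norm : forall x, Omega x -> is_norm (phi x))
  (primal_bounded : exists m : R,
     lbound (primal_values Omega phi F H) m%:E) :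
  exists N : 'rV[R]_n -> 'rV[R]_n,
    [/\ dual_feasible Omega phi H N,
        dual_value Omega F N = dual_sup Omega phi F H,
        primal_inf Omega phi F H = dual_value Omega F N &
        forall u G, primal_minimizer Omega phi F H u G ->
          {ae lebesgue_rV n, forall x, Omega x -> G x + F x != 0 ->
             let nu := (enorm (G x + F x))^-1 *: (G x + F x) in
             phi x nu = dotv (N x) nu}].
Proof.
have [_ oO _] := dom_Omega.
have [alpha alpha0 phi_alpha] := phi_growth; have [m primal_ge] := primal_bounded.
apply: (dual_attainment oO bnd_Omega F_L2 H_L2 phi_cont alpha0 _ phi_norm primal_ge).
by move=> x xi Ox; have /andP[] := phi_alpha x xi Ox.
Qed.
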